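(* Let $p(x)$ be a partial type over a set $A$. The following are equivalent: (1) $p$ is stable. (2) For every $a$ realizing $p$ and every increasing chain $(B_j : j\in|T|^+)$ of sets containing $A$, there is some $j\in|T|^+$ such that $a$ is $i$-independent from $B_{j+1}$ over $B_j$. (3) For every $a$ realizing $p$ and every $(|A|+|T|)^+$-saturated model $M\supseteq A$, there is some $C\subseteq M$ with $|C|\le|T|$ such that $a$ is $i$-independent from $M$ over $AC$. (4) For every $a$ realizing $p$ and every $B\supseteq A$, there is some $C\subseteq B$ with $|C|\le|T|$ such that $a$ is $i$-independent from $B$ over $AC$.
   Context: $T$ is a complete first-order theory in a language $L$ with a monster model $\mathfrak C$ that is $\bar\kappa$-saturated and strongly $\bar\kappa$-homogeneous for a sufficiently large cardinal $\bar\kappa$; all parameter sets are small subsets of $\mathfrak C$ and models are small elementary submodels of $\mathfrak C$. $|T|$ denotes the (infinite) cardinal $|L|+\aleph_0$. A global type is a complete type over $\mathfrak C$. $x$ is a finite tuple of variables. $AC$ denotes $A\cup C$. Stable: a partial type $p$ over $A$ is stable if for some (small) cardinal $\lambda\ge|A|+|T|$ and for every $B\supseteq A$ with $|B|\le\lambda$, there are at most $\lambda$ types in $S(B)$ extending $p$. Lascar-splitting: $Autf(\mathfrak C/A)$ is the subgroup of $Aut(\mathfrak C/A)$ generated by the automorphisms fixing pointwise some model containing $A$. Write $a\stackrel{Ls}{\equiv}_A b$ if $a,b$ are in the same orbit under $Autf(\mathfrak C/A)$. A complete type $p(x)$ over $B\supseteq A$ (possibly $B=\mathfrak C$) Lascar-splits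 over $A$ if for some formula $\varphi(x,y)\in L$ there are tuples $a,b\in B$ with $a\stackrel{Ls}{\equiv}_A b$, $\varphi(x,a)\in p$ and $\neg\varphi(x,b)\in p$. $i$-independence: $a$ is $i$-independent from $B$ over $C$ if there is a global extension of $tp(a/BC)$ that does not Lascar-split over $C$. *)

(* Defs.v *)
From mathcomp Require Import all_boot all_classical.
From mathcomp Require wochoice.
Set Implicit Arguments.
Unset Strict Implicit.
Unset Printing Implicit Defensive.

Local Open Scope classical_set_scope.
Local Open Scope card_scope.

(** A cardinal is given by a type, or a set, of that size. *)

Definition card_lt T U (A : set T) (B : set U) : Prop := A #<= B /\ ~ (B #<= A).

Definition strong_limit (K : Type) : Prop :=
  forall X : Type, card_lt [set: X] [set: K] -> card_lt [set: set X] [set: K].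

(** [R] is the reflexive order; the conditions say that the order type of
    [(J, R)] is the initial ordinal of the successor of the cardinal of [X]. *)
Definition order_type_succ_card (X : Type) (J : Type) (R : rel J) : Prop :=
  [/\ wochoice.well_order R,
      ~ ([set: J] #<= [set: X])
    & forall j, [set i | R i j /\ i <> j] #<= [set: X]].

Definition is_succ (J : Type) (R : rel J) (j k : J) : Prop :=
  (R j k /\ j <> k) /\ forall l, R j l -> j <> l -> R k l.

Record language := Language {
  fsym : Type; far : fsym -> nat;
  rsym : Type; rar : rsym -> nat }.

(** A type of cardinality [|L| + aleph_0], that is, [|T|]. *)
Definition lang_card (L : language) : Type := (fsym L + rsym L + nat)%type.

Inductive term (L : language) (n : nat) : Type :=
| TVar of 'I_n
| TApp (f : fsym L) of ('I_(far f) -> term L n).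

(** [formula L n]: formulas with free variables among [v_0, ..., v_{n-1}];
    [FEx] binds variable [0]. *)
Inductive formula (L : language) (n : nat) : Type :=
| FEq of term L n & term L n
| FRel (r : rsym L) of ('I_(rar r) -> term L n)
| FNot of formula L n
| FAnd of formula L n & formula L n
| FEx of formula L n.+1.

Record structure (L : language) (D : Type) := Structure {
  dom_inh : inhabited D;
  ifun : forall f : fsym L, ('I_(far f) -> D) -> D;
  irel : forall r : rsym L, ('I_(rar r) -> D) -> Prop }.

Definition tcons D n (x : D) (v : 'I_n -> D) : 'I_n.+1 -> D :=
  fun k => if unlift ord0 k is Some i then v i else x.

Definition tcat D n m (a : 'I_n -> D) (b : 'I_m -> D) : 'I_(n + m) -> D :=
  fun k => match fintype.split k with inl i => a i | inr j => b j end.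

Fixpoint teval L D (S : structure L D) n (v : 'I_n -> D) (t : term L n) : D :=
  match t with
  | TVar i => v i
  | TApp f ts => ifun S (fun i => teval S v (ts i))
  end.

Fixpoint sat L D (S : structure L D) n (phi : formula L n) : ('I_n -> D) -> Prop :=
  match phi with
  | FEq t u => fun v => teval S v t = teval S v u
  | FRel r ts => fun v => irel S (fun i => teval S v (ts i))
  | FNot psi => fun v => ~ sat S psi v
  | FAnd psi chi => fun v => sat S psi v /\ sat S chi v
  | FEx psi => fun v => exists x, sat S psi (tcons x v)
  end.

Definition sentence L := formula L 0.

Definition holds L D (S : structure L D) (s : sentence L) : Prop :=
  forall v : 'I_0 -> D, sat S s v.

Definition models L D (S : structure L D) (T : set (sentence L)) : Prop :=
  forall s, T s -> holds S s.

Definition entails L (T : set (sentence L)) (s : sentence L) : Prop :=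
  forall (D : Type) (S : structure L D), models S T -> holds S s.

Definition complete_theory L (T : set (sentence L)) : Prop :=
  (exists (D : Type) (S : structure L D), models S T) /\
  forall s, entails T s \/ entails T (FNot s).

Section Structure.
Variables (L : language) (D : Type) (S : structure L D).

Definition automorphism (sigma : D -> D) : Prop :=
  [/\ bijective sigma,
      forall f (v : 'I_(far f) -> D), sigma (ifun S v) = ifun S (sigma \o v)
    & forall r (v : 'I_(rar r) -> D), irel S (sigma \o v) <-> irel S v].

Definition elementary_submodel (N : set D) : Prop :=
  exists SN : structure L N,
    forall n (phi : formula L n) (v : 'I_n -> N),
      sat SN phi v <-> sat S phi (val \o v).

Definition elementary_on (B : set D) (f : D -> D) : Prop :=
  forall n (phi : formula L n) (v : 'I_n -> D), (forall i, B (v i)) ->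
    (sat S phi v <-> sat S phi (f \o v)).

(** An [L(D)]-formula [phi(x, b)] in a tuple [x] of [n] variables, as a formula
    [phi(x, y)] together with the tuple of parameters [b] to be put for [y]. *)
Record pformula (n : nat) := PFormula {
  pf_len : nat;
  pf_fml : formula L (n + pf_len);
  pf_par : 'I_pf_len -> D }.
Arguments pf_par {n} p _.

Definition pf_over (B : set D) n : set (pformula n) :=
  [set psi | forall i, B (pf_par psi i)].

Definition pf_sat n (a : 'I_n -> D) (psi : pformula n) : Prop :=
  sat S (pf_fml psi) (tcat a (pf_par psi)).

Definition pf_neg n (psi : pformula n) : pformula n :=
  PFormula (FNot (pf_fml psi)) (pf_par psi).

Definition realizes n (a : 'I_n -> D) (p : set (pformula n)) : Prop :=
  forall psi, p psi -> pf_sat a psi.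

Definition partial_type n (A : set D) (p : set (pformula n)) : Prop :=
  p `<=` @pf_over A n /\
  forall F : set (pformula n), finite_set F -> F `<=` p -> exists a, realizes a F.

(** This is [S_n(B)]. *)
Definition complete_type n (B : set D) : set (set (pformula n)) :=
  [set q | partial_type B q /\
           forall psi, pf_over B psi -> q psi \/ q (pf_neg psi)].

Definition tp n (a : 'I_n -> D) (B : set D) : set (pformula n) :=
  [set psi | pf_over B psi /\ pf_sat a psi].

(** With [small X] meaning [|X| < kappa], this says that [N] is
    [kappa]-saturated. Types are taken in the ambient structure; this agrees
    with types in [N] as [N] is always an elementary submodel. *)
Definition saturated (small : set D -> Prop) (N : set D) : Prop :=
  forall (B : set D) n (q : set (pformula n)),
    B `<=` N -> small B -> complete_type B q ->
    exists2 a : 'I_n -> D, (forall i, N (a i)) & realizes a q.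

Definition strongly_homogeneous (small : set D -> Prop) : Prop :=
  forall (B : set D) (f : D -> D), small B -> elementary_on B f ->
    exists2 sigma, automorphism sigma & {in B, sigma =1 f}.

(** The type [K] stands for the cardinal kappa-bar. *)

Definition is_small (K : Type) (X : set D) : Prop := card_lt X [set: K].

(** That kappa-bar is sufficiently large is read as: a strong limit above [|T|]. *)
Record monster_model (T : set (sentence L)) (K : Type) : Prop := MonsterModel {
  monster_models : models S T;
  monster_limit : strong_limit K;
  monster_large : card_lt [set: lang_card L] [set: K];
  monster_saturated : saturated (is_small K) setT;
  monster_homogeneous : strongly_homogeneous (is_small K) }.

Section Monster.
Variable K : Type.

Definition model (N : set D) : Prop := elementary_submodel N /\ is_small K N.

Definition stable n (A : set D) (p : set (pformula n)) : Prop :=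
  exists Lam : Type,
    [/\ card_lt [set: Lam] [set: K],
        [set: (A + lang_card L)%type] #<= [set: Lam]
      & forall B : set D, A `<=` B -> B #<= [set: Lam] ->
          [set q | complete_type B q /\ p `<=` q] #<= [set: Lam]].

Inductive Autf (A : set D) : (D -> D) -> Prop :=
| Autf_gen sigma N : automorphism sigma -> model N -> A `<=` N ->
    {in N, sigma =1 id} -> Autf A sigma
| Autf_id : Autf A id
| Autf_comp sigma tau : Autf A sigma -> Autf A tau -> Autf A (sigma \o tau)
| Autf_inv sigma tau : Autf A sigma -> cancel sigma tau -> cancel tau sigma ->
    Autf A tau.

Definition Ls_equiv (A : set D) m (a b : 'I_m -> D) : Prop :=
  exists2 sigma, Autf A sigma & forall i, sigma (a i) = b i.

Definition Lascar_splits n (B A : set D) (p : set (pformula n)) : Prop :=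
  exists (m : nat) (phi : formula L (n + m)) (a b : 'I_m -> D),
    [/\ forall i, B (a i), forall i, B (b i), Ls_equiv A a b,
        p (PFormula phi a) & p (PFormula (FNot phi) b)].

Definition i_indep n (a : 'I_n -> D) (B C : set D) : Prop :=
  exists q : set (pformula n),
    [/\ complete_type setT q, tp a (B `|` C) `<=` q
      & ~ Lascar_splits setT C q].

End Monster.
End Structure.

(* Main.v *)
Require Import Defs.
From mathcomp Require Import all_boot all_classical.
From mathcomp Require wochoice.

Set Implicit Arguments.
Unset Strict Implicit.
Unset Printing Implicit Defensive.

Local Open Scope classical_set_scope.
Local Open Scope card_scope.

(** Global types are handled as ultrafilters on the set of [n]-tuples of the
    monster model.

    (1) => (2). Stability makes every local 2-rank finite on [p]. Among the
    systems [G] of proper filters indexed by the chain, increasing, invariant,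
    with [G j] over [B_j] and containing [tp(a/B_j)], take a maximal one. Adding
    to each [G j] the complements of the sets of small [phi]-rank gives another
    such system as long as it stays proper, so by maximality [G j] has only
    finitely many [phi]-types above it from some [j] on. As the chain has length
    [|T|^+], one [j] serves all [phi] at once. "Every ultrafilter above [G j]
    contains both or neither of [phi(x, b)], [phi(x, c)]" is then an invariant
    equivalence relation with finitely many classes, so it is coarser than
    Lascar equivalence over [B_j], and any ultrafilter above [G (j + 1)] shows
    that [a] is i-independent from [B_(j+1)] over [B_j].

    (2) => (4). Failure of i-independence is witnessed by finitely many
    parameters, so a counterexample to (4) yields a chain contradicting (2).

    (3) => (1). Let [mu = |A| + |T|] and let [Lam] be [2 ^ 2 ^ 2 ^ mu]. A set of
    size at most [Lam] lies in a saturated model [M] of size at most [Lam]. A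
    global type not Lascar-splitting over [A] and a [C] in [M] of size at most
    [|T|] is determined on [M] by the types that parameters realize over a
    model of size [2 ^ mu] containing [A] and [C]; hence at most [Lam] types
    over [M] extend [p]. *)

(** * Cardinal arithmetic *)

Lemma sval_inj (X : Type) (P : X -> Prop) : injective (@sval X P).
Proof. by move=> [x p] [y q] /= E; exact: eq_exist. Qed.

Definition emb (X Y : Type) : Prop := exists f : X -> Y, injective f.

Lemma emb_refl X : emb X X.
Proof. by exists id. Qed.

Lemma emb_trans X Y Z : emb X Y -> emb Y Z -> emb X Z.
Proof. by move=> [f fi] [g gi]; exists (g \o f); apply: inj_comp. Qed.

Lemma emb_rel X Y (Q : X -> Y -> Prop) :
  (forall x, exists y, Q x y) -> (forall x x' y, Q x y -> Q x' y -> x = x') ->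
  emb X Y.
Proof.
move=> /choice [f fQ] h; exists f => x x' e.
by apply: h (fQ x) _; rewrite e.
Qed.

Lemma emb_fun X Y Z : emb X Y -> emb (Z -> X) (Z -> Y).
Proof.
move=> [f fi]; exists (fun g => f \o g) => g g' /funeqP e.
by apply/funext => z; apply: fi; exact: (e z).
Qed.

Lemma emb_prod X X' Y Y' : emb X X' -> emb Y Y' -> emb (X * Y) (X' * Y').
Proof.
move=> [f fi] [g gi]; exists (fun p => (f p.1, g p.2)).
by move=> [x y] [x' y'] [/fi -> /gi ->].
Qed.

Lemma emb_sum X X' Y Y' : emb X X' -> emb Y Y' -> emb (X + Y) (X' + Y').
Proof.
move=> [f fi] [g gi].
exists (fun p => match p with inl x => inl (f x) | inr y => inr (g y) end).
by move=> [x|y] [x'|y'] //= [] => [/fi ->|/gi ->].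
Qed.

Lemma emb_set X Y : emb X Y -> emb (set X) (set Y).
Proof.
move=> [f fi]; exists (fun P => f @` P) => P Q e; apply/predeqP => x.
have aux (U V : set X) : f @` U = f @` V -> U x -> V x.
  by move=> h Ux; have [y Vy /fi <-//] : (f @` V) (f x) by rewrite -h; exists x.
by split; apply: aux.
Qed.

Lemma emb_set1 X : emb X (set X).
Proof. by exists set1 => x y /predeqP /(_ x) [/(_ erefl)]. Qed.

Lemma cantor X : ~ emb (set X) X.
Proof.
move=> [f fi]; pose U : set X := fun x => exists2 V, f V = x & ~ V x.
have : ~ U (f U) by move=> UU; have [V /fi -> h] := UU; apply: h.
by move=> nU; apply: (nU); exists U.
Qed.

Lemma card_leP_emb (X Y : Type) (A : set X) (B : set Y) : A #<= B <-> emb A B.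
Proof.
split=> [/card_leP [f]|[f fi]].
  by exists f => x y; apply: inj; rewrite inE.
apply/card_leP/injfunPex; exists f => // x y _ _; exact: fi.
Qed.

Lemma emb_setT X : emb X [set: X] /\ emb [set: X] X.
Proof.
split; first by exists (fun x => exist _ x (mem_set (I : setT x))) => x y [].
by exists val; exact: val_inj.
Qed.

Lemma card_le_embE (X Y : Type) : [set: X] #<= [set: Y] <-> emb X Y.
Proof.
rewrite card_leP_emb; split=> h.
  exact: emb_trans (emb_setT X).1 (emb_trans h (emb_setT Y).2).
exact: emb_trans (emb_setT X).2 (emb_trans h (emb_setT Y).1).
Qed.

Lemma card_le_emb (X Y : Type) (A : set X) : A #<= [set: Y] <-> emb A Y.
Proof.
rewrite card_leP_emb; split=> h; first exact: emb_trans h (emb_setT Y).2.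
exact: emb_trans h (emb_setT Y).1.
Qed.

(** Relational form for counting by codes: an element may have several codes and some codes may be
    idle, so none has to be chosen. *)
Lemma card_leE_rel (X Y : Type) (A : set X) : A #<= [set: Y] <->
  exists2 Q : Y -> X -> Prop, (forall y x x', Q y x -> Q y x' -> x = x') &
    forall x, A x -> exists y, Q y x.
Proof.
rewrite card_le_emb; split=> [[f fi]|[Q Q1 Q2]].
  exists (fun y x => exists2 h : x \in A, f (exist _ x h) = y & True).
      by move=> y x x' [h <- _] [h' /fi []].
  by move=> x /mem_set Ax; exists (f (exist _ x Ax)), Ax.
apply: (@emb_rel _ _ (fun a y => Q y (val a))) => [a|a b y Qa Qb].
  by apply: Q2; apply: set_mem; apply: valP.
exact/val_inj/(Q1 y).
Qed.

Lemma card_le_range (X Y : Type) (A : set X) (f : Y -> X) :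
  (forall x, A x -> exists y, f y = x) -> A #<= [set: Y].
Proof. by move=> h; apply/card_leE_rel; exists (fun y x => f y = x) => // y x x' ->. Qed.

Lemma card_le_rangeP (X Y : Type) (A : set X) (x0 : X) : A x0 ->
  A #<= [set: Y] -> exists2 f : Y -> X, (forall y, A (f y)) & forall x, A x -> exists y, f y = x.
Proof.
move=> A0 /card_leE_rel [Q Q1 Q2].
have /choice [f fP] (y : Y) : exists x, (exists2 x', A x' & Q y x') -> A x /\ Q y x.
  have [[x' Ax Qx]|n] := EM (exists2 x', A x' & Q y x'); first by exists x'.
  by exists x0.
exists (fun y => if pselect (A (f y)) then f y else x0) => [y|x Ax].
  by case: pselect.
have [y Qy] := Q2 x Ax; exists y.
have [|h1 h2] := fP y; first by exists x.
by case: pselect => // ? /=; apply: Q1 h2 Qy.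
Qed.

Lemma card_le_trans_emb (X Y Z : Type) (A : set X) :
  A #<= [set: Y] -> emb Y Z -> A #<= [set: Z].
Proof. by move=> h /card_le_embE; exact: card_le_trans h. Qed.

(** Zorn on graphs of partial injections: a maximal graph is total or onto, since otherwise a pair
    of missed points could be added. *)
Lemma emb_total X Y : emb X Y \/ emb Y X.
Proof.
pose P (G : set (X * Y)) :=
  (forall x y y', G (x, y) -> G (x, y') -> y = y') /\
  (forall x x' y, G (x, y) -> G (x', y) -> x = x').
have [F FP tot|G [[G1 G2] Gmax]] := @Zorn_bigcup _ P.
  split=> [x y y'|x x' y] [G1 F1 g1] [G2 F2 g2].
    case: (tot _ _ F1 F2) => s; first by apply: (FP _ F2).1 (s _ g1) g2.
    by apply: (FP _ F1).1 g1 (s _ g2).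
  case: (tot _ _ F1 F2) => s; first by apply: (FP _ F2).2 (s _ g1) g2.
  by apply: (FP _ F1).2 g1 (s _ g2).
have [h|/existsNP [x nx]] := EM (forall x, exists y, G (x, y)).
  by left; exact: emb_rel h G2.
right; apply: (@emb_rel _ _ (fun y x => G (x, y))) => [y|y y' u]; last exact: G1.
apply: contrapT => ny; apply: (Gmax (G `|` [set (x, y)])).
  split; first by move=> z; left.
  by move=> /(_ (x, y)) s; apply: nx; exists y; apply: s; right.
split=> [x1 y1 y2|x1 x2 y1]; move=> [g1|[e1 e2]] [g2|[e3 e4]]; subst => //.
- exact: G1 g1 g2.
- by case: nx; exists y1.
- by case: nx; exists y2.
- exact: G2 g1 g2.
- by case: ny; exists x1.
- by case: ny; exists x2.
Qed.

(** * Squares of infinite cardinals *)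

Section Square.
Variables (X : Type) (e : nat -> X) (e_inj : injective e).

(** [G] is read as a pairing relation, [z] being a code of [(x, y)]; [dm] recovers its underlying
    set from the diagonal. A pair may have several codes, among which a choice is made later. *)
Let dm (G : set (X * X * X)) x := exists z, G (x, x, z).

Let good (G : set (X * X * X)) :=
  [/\ forall x y z, G (x, y, z) -> [/\ dm G x, dm G y & dm G z],
      forall x y, dm G x -> dm G y -> exists z, G (x, y, z)
    & forall x y x' y' z, G (x, y, z) -> G (x', y', z) -> x = x' /\ y = y'].

Let G0 : set (X * X * X) :=
  [set t | exists a b, t = (e a, e b, e (pickle (a, b)))].

Let good0 : good G0.
Proof.
have d a : dm G0 (e a) by exists (e (pickle (a, a))); exists a, a.
split=> [x y z [a [b [-> -> ->]]]|x y [z [a [b [-> _ _]]]] [z' [c [b' [-> _ _]]]]|].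
- by split; apply: d.
- by eexists; exists a, c.
- move=> x y x' y' z [a [b [-> -> ->]]] [c [d' [-> -> /e_inj]]].
  by move=> /(pcan_inj pickleK) [-> ->].
Qed.

(** Zorn gives a maximal set [A] with an injective pairing into itself. If a disjoint copy of [A]
    existed, the pairing would extend to the union of [A] and the copy, with all new codes in the
    copy. *)
Lemma ex_maximal_square : exists A : set X, exists pr : X -> X -> X,
  [/\ A (e 0), A (e 1),
      forall x y, A x -> A y -> A (pr x y),
      forall x y x' y', A x -> A y -> A x' -> A y' ->
        pr x y = pr x' y' -> x = x' /\ y = y'
    & ~ exists f : X -> X, [/\ forall x, A x -> ~ A (f x) & {in A &, injective f}]].
Proof.
(* The guard [G !=set0] makes [P] hold of the union of the empty chain. *)
pose P G := G !=set0 -> G0 `<=` G /\ good G.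
have [F FP tot|G [GP Gmax]] := @Zorn_bigcup _ P.
  move=> [t0 [H0 F0 Ht0]].
  have ne H t : F H -> H t -> G0 `<=` H /\ good H by move=> FH Ht; apply: FP FH _; exists t.
  have dmS H x : F H -> dm H x -> dm (\bigcup_(H in F) H) x.
    by move=> FH [z Hz]; exists z, H.
  split; first by move=> t Gt; exists H0 => //; exact: (ne _ _ F0 Ht0).1.
  split.
  - move=> x y z [H FH Hz]; have [_ [g _ _]] := ne _ _ FH Hz.
    by have [a b c] := g _ _ _ Hz; split; apply: (dmS H).
  - move=> x y [z [H FH Hz]] [z' [H' FH' Hz']].
    suff [H1 [F1 d d']] : exists H1, [/\ F H1, dm H1 x & dm H1 y].
      have [w Hw] := d; have [_ [_ g _]] := ne _ _ F1 Hw.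
      by have [v] := g _ _ d d'; exists v, H1.
    case: (tot _ _ FH FH') => s.
      by exists H'; split=> //; [exists z; apply: s|exists z'].
    by exists H; split=> //; [exists z|exists z'; apply: s].
  - move=> x y x' y' z [H FH Hz] [H' FH' Hz'].
    case: (tot _ _ FH FH') => s.
      by have [_ [_ _ g]] := ne _ _ FH' Hz'; apply: g (s _ Hz) Hz'.
    by have [_ [_ _ g]] := ne _ _ FH Hz; apply: g Hz (s _ Hz').
have Gne : G !=set0.
  apply: contrapT => n; apply: (Gmax G0).
    split; first by move=> t Gt; case: n; exists t.
    by move=> s; apply: n; exists (e 0, e 0, e (pickle (0, 0))); apply: s; exists 0, 0.
  by move=> _; split=> //.
have {GP} [GG0 [g1 g2 g3]] := GP Gne.
have dme a : dm G (e a) by exists (e (pickle (a, a))); apply: GG0; exists a, a.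
have /choice [pr prP] (xy : X * X) : exists z, dm G xy.1 -> dm G xy.2 -> G (xy.1, xy.2, z).
  have [[d d']|n] := EM (dm G xy.1 /\ dm G xy.2).
    by have [z ?] := g2 _ _ d d'; exists z.
  by exists xy.1 => d d'; case: n.
pose p x y := pr (x, y).
have pP x y : dm G x -> dm G y -> G (x, y, p x y) by exact: (prP (x, y)).
have pA x y : dm G x -> dm G y -> dm G (p x y).
  by move=> dx dy; have [] := g1 _ _ _ (pP _ _ dx dy).
have pI x y x' y' : dm G x -> dm G y -> dm G x' -> dm G y' ->
    p x y = p x' y' -> x = x' /\ y = y'.
  by move=> d1 d2 d3 d4 E; apply: g3 (pP _ _ d1 d2) _; rewrite E; apply: pP.
exists (dm G), p; split=> // -[f [fn fi]].
pose A' x := dm G x \/ exists2 a, dm G a & f a = x.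
have fi' a b : dm G a -> dm G b -> f a = f b -> a = b.
  by move=> da db; apply: fi; rewrite inE.
(* [k] injects the union [A'] into [dm G], tagging the two halves by [e 0] and [e 1]. *)
have [k kP] : exists k : X -> X, (forall x, A' x -> dm G (k x)) /\
    forall x y, A' x -> A' y -> k x = k y -> x = y.
  have /choice [h hP] (x : X) : exists a, (exists2 a, dm G a & f a = x) -> dm G a /\ f a = x.
    have [[a da E]|n] := EM (exists2 a, dm G a & f a = x); first by exists a.
    by exists x => ?; case: n.
  exists (fun x => if pselect (dm G x) then p x (e 0) else p (h x) (e 1)); split.
    move=> x [dx|fx]; case: pselect => // d; try exact: pA.
    by apply: pA => //; have [] := hP x fx.
  move=> x y Ax Ay; case: pselect => dx; case: pselect => dy.
  - by move=> /pI [].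
  - case: Ay => // fy; have [d _] := hP _ fy.
    by move=> /pI [] // _ /e_inj.
  - case: Ax => // fx; have [d _] := hP _ fx.
    by move=> /pI [] // _ /e_inj.
  - case: Ay => // fy; case: Ax => // fx.
    have [d E] := hP _ fx; have [d' E'] := hP _ fy.
    by move=> /pI [] // H _; rewrite -E -E' H.
have [kA kI] := kP.
(* New pairs get codes in the copy, outside [dm G], so they cannot clash with old codes. *)
pose N : set (X * X * X) := [set t | [/\ A' t.1.1, A' t.1.2, ~ (dm G t.1.1 /\ dm G t.1.2)
    & t.2 = f (p (k t.1.1) (k t.1.2))]].
have dmN x : dm (G `|` N) x <-> A' x.
  split=> [[z [Gz|[]//]]|]; first by left; exists z.
  move=> Ax; have [[z Gz]|n] := EM (dm G x); first by exists z; left.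
  by eexists; right; split=> //=; case.
have A'f x : dm G x -> A' (f x) by right; exists x.
apply: (Gmax (G `|` N)).
  split; first by move=> t; left.
  move=> s; have : dm (G `|` N) (f (e 0)) by apply/dmN/A'f.
  by move=> [z /s Gz]; apply: (fn (e 0)) => //; exists z.
move=> _; split; first by move=> t /GG0; left.
split.
- move=> x y z [Gz|[/= Ax Ay nn ->]].
    by have [a b c] := g1 _ _ _ Gz; split; apply/dmN; left.
  by split; apply/dmN => //; apply: A'f; apply: pA; apply: kA.
- move=> x y /dmN Ax /dmN Ay.
  have [[dx dy]|n] := EM (dm G x /\ dm G y).
    by have [z ?] := g2 _ _ dx dy; exists z; left.
  by eexists; right; split=> /=.
- move=> x y x' y' z [Gz|[/= Ax Ay nn ->]] [Gz'|[/= Ax' Ay' nn' E]].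
  + exact: g3 Gz Gz'.
  + have [_ _] := g1 _ _ _ Gz; rewrite E => /(fn _ _) [].
    by apply: pA; apply: kA.
  + have [_ _] := g1 _ _ _ Gz' => /(fn _ _) [].
    by apply: pA; apply: kA.
  + have {}E := fi' _ _ (pA _ _ (kA _ Ax) (kA _ Ay)) (pA _ _ (kA _ Ax') (kA _ Ay')) E.
    have [] := pI _ _ _ _ (kA _ Ax) (kA _ Ay) (kA _ Ax') (kA _ Ay') E.
    by move=> /(kI _ _ Ax Ax') -> /(kI _ _ Ay Ay') ->.
Qed.

(** For the maximal [A], comparability embeds the complement of [A] into [A]; hence all of [X]
    embeds into [A], where pairs can be coded. *)
Lemma emb_square_of_seq : emb (X * X) X.
Proof.
have [A [p [A0 A1 pA pI nf]]] := ex_maximal_square.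
have [[f fi]|[f fi]] := emb_total {x | A x} {x | ~ A x}.
  case: nf; exists (fun x => if pselect (A x) is left h then sval (f (exist _ x h)) else x).
  split=> [x Ax|x y].
    by case: pselect => // h; exact: (svalP (f _)).
  rewrite !inE => Ax Ay; case: pselect => // h; case: pselect => // h' E.
  by have /fi [] : f (exist _ x h) = f (exist _ y h') by exact: sval_inj.
pose k x := match pselect (A x) with left _ => p x (e 0)
            | right h => p (sval (f (exist _ x h))) (e 1) end.
have fA x : A (sval (f x)) by exact: svalP.
have kA x : A (k x) by rewrite /k; case: pselect => h; apply: pA.
have kI : injective k.
  move=> x y; rewrite /k; case: pselect => h; case: pselect => h' /pI [] // E.
  - by move/e_inj.
  - by move/e_inj.
  - move=> _; suff /fi [] : f (exist _ x h) = f (exist _ y h') by [].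
    exact: sval_inj.
by exists (fun q => p (k q.1) (k q.2)) => -[x y] [x' y'] /= /pI [] // /kI -> /kI ->.
Qed.

End Square.

Lemma emb_square X : emb nat X -> emb (X * X) X.
Proof. by move=> [e ei]; exact: emb_square_of_seq ei. Qed.

Lemma emb_ord k X : emb nat X -> emb 'I_k X.
Proof. by move=> h; apply: emb_trans h; exists val; apply: val_inj. Qed.

Section Infinite.
Variables (X : Type) (iX : emb nat X).

Lemma emb_sum_le Y Z : emb Y X -> emb Z X -> emb (Y + Z) X.
Proof.
move=> h h'; apply: emb_trans (emb_sum h h') _.
have [e ei] := iX; apply: emb_trans (emb_square iX).
exists (fun p => match p with inl x => (x, e 0) | inr x => (x, e 1) end).
by move=> [x|x] [y|y] [-> //] /ei.
Qed.

Lemma emb_prod_le Y Z : emb Y X -> emb Z X -> emb (Y * Z) X.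
Proof. by move=> h h'; apply: emb_trans (emb_prod h h') (emb_square iX). Qed.

Lemma emb_seq Y : emb Y X -> emb (seq Y) X.
Proof.
move=> h; have [p pi] := emb_prod_le h (emb_refl X); have [e ei] := iX.
(* Iterated pairing ends in the default [e 0]; the size stored beside it separates sequences of
   different lengths. *)
pose g := fix g (s : seq Y) := if s is x :: s' then p (x, g s') else e 0.
apply: (@emb_trans _ (nat * X)); last exact: emb_prod_le iX (emb_refl X).
exists (fun s => (size s, g s)); elim=> [|x s IH] [|y t] //= [e1 /pi [-> e2]].
by rewrite (IH t) // e1 e2.
Qed.

Lemma emb_sigma_le (I : Type) (F : I -> Type) :
  emb I X -> (forall i, emb (F i) X) -> emb {i & F i} X.
Proof.
move=> [u ui] h; pose f i := sval (cid (h i)).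
have fi i : injective (f i) by rewrite /f; case: cid.
apply: emb_trans (emb_square iX).
exists (fun p => (u (projT1 p), f (projT1 p) (projT2 p))).
by move=> [i x] [i' y] /= [/ui E]; subst => /fi ->.
Qed.

Lemma emb_tuple k Y : emb Y X -> emb ('I_k -> Y) X.
Proof.
move=> h; apply: emb_trans (emb_seq h).
exists (fun f => [seq f i | i <- enum 'I_k]) => f g /eq_in_map E.
by apply/funext => i; apply: E; rewrite mem_enum.
Qed.

Lemma card_le_bigcup D (I : Type) (F : I -> set D) :
  emb I X -> (forall i, F i #<= [set: X]) -> \bigcup_i F i #<= [set: X].
Proof.
move=> iI h; have {h} /choice [Q QP] (i : I) : exists Q : X -> D -> Prop,
   (forall y x x', Q y x -> Q y x' -> x = x') /\ forall x, F i x -> exists y, Q y x.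
  by have /card_leE_rel [Q ? ?] := h i; exists Q.
apply: card_le_trans_emb (emb_prod_le iI (emb_refl X)).
apply/card_leE_rel; exists (fun p => Q p.1 p.2) => [p x x'|x [i _ Fx]].
  exact: (QP p.1).1.
by have [y] := (QP i).2 _ Fx; exists (i, y).
Qed.

Lemma card_leU D (A B : set D) :
  A #<= [set: X] -> B #<= [set: X] -> A `|` B #<= [set: X].
Proof.
move=> hA hB; pose F (b : bool) := if b then A else B.
have iF : emb bool X.
  by apply: emb_trans iX; exists nat_of_bool => -[] [].
apply: card_le_trans (card_le_bigcup (F := F) iF _); last by case.
by apply: subset_card_le => x [] h; [exists true|exists false].
Qed.

Lemma card_le_finite_set D (A : set D) : finite_set A -> A #<= [set: X].
Proof.
move=> /finite_set_countable h; exact: card_le_trans_emb h iX.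
Qed.

End Infinite.

Lemma emb_uncurry X Y : emb (X -> set Y) (set (X * Y)).
Proof.
exists (fun f p => f p.1 p.2) => f g /funeqP E; apply/funext => x; apply/funext => y.
exact: E (x, y).
Qed.

(* [(2 ^ X) ^ Y = 2 ^ (X * Y) = 2 ^ X] *)
Lemma emb_fun_set X Y : emb nat X -> emb Y X -> emb (Y -> set X) (set X).
Proof.
move=> iX h; apply: emb_trans (@emb_uncurry _ _) (emb_set _).
exact: emb_prod_le (emb_refl X).
Qed.

Lemma emb_set_infinite X : emb nat X -> emb nat (set X).
Proof. by move=> h; apply: emb_trans h (@emb_set1 X). Qed.

(** * Well-orders and successor cardinals *)

Section WellOrder.
Variables (J : Type) (R : rel J) (hR : wochoice.well_order R).

Definition slt i j := R i j /\ i <> j.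

Lemma wo_min (P : J -> Prop) : (exists j, P j) -> exists2 j, P j & forall i, P i -> R j i.
Proof.
move=> [j Pj]; have [|m [[Pm mP] _]] := hR (A := [pred x | `[<P x>]]).
  by exists j; apply/asboolP.
by exists m => [|i Pi]; [apply/asboolP|apply/mP/asboolP].
Qed.

Lemma wo_total i j : R i j \/ R j i.
Proof.
have [|m] := @wo_min (fun x => x = i \/ x = j); first by exists i; left.
by move=> [->|->] h; [left|right]; apply: h; [right|left].
Qed.

Lemma wo_refl i : R i i.
Proof. by have [] := wo_total i i. Qed.

Lemma wo_anti i j : R i j -> R j i -> i = j.
Proof.
move=> ij ji; have [|m [_ h]] := hR (A := [pred x | (`[<x = i>] || `[<x = j>])]).
  by exists i; rewrite inE asboolT.
rewrite -(h i) ?(h j) //.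
- split; first by rewrite !inE [X in _ || X]asboolT ?orbT.
  by move=> x; rewrite inE => /orP [] /asboolP -> //; apply: wo_refl.
- split; first by rewrite !inE asboolT.
  by move=> x; rewrite inE => /orP [] /asboolP -> //; apply: wo_refl.
Qed.

Lemma wo_trans i j k : R i j -> R j k -> R i k.
Proof.
move=> ij jk; have [|m [->|[->|->]] h] := @wo_min (fun x => x = i \/ x = j \/ x = k).
- by exists i; left.
- by apply: h; right; right.
- have ji : R j i by apply: h; left.
  by rewrite (wo_anti ij ji).
- have ki : R k i by apply: h; left.
  have kj : R k j by apply: h; right; left.
  by rewrite -(wo_anti jk kj).
Qed.

Lemma slt_trans i j k : slt i j -> slt j k -> slt i k.
Proof.
move=> [ij nij] [jk njk]; split; first exact: wo_trans ij jk.
by move=> E; subst; apply: nij; apply: wo_anti.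
Qed.

Lemma slt_total i j : [\/ slt i j, i = j | slt j i].
Proof.
have [->|n] := EM (i = j); first by constructor 2.
have [h|h] := wo_total i j; first by constructor 1.
by constructor 3; split=> // E; apply: n.
Qed.

Lemma not_slt i j : ~ slt i j -> R j i.
Proof.
by move=> n; case: (slt_total i j) => [//|->|[]//]; apply: wo_refl.
Qed.

Lemma slt_wf : well_founded slt.
Proof.
move=> j; apply: contrapT => n.
have [|m nm h] := @wo_min (fun x => ~ Acc slt x); first by exists j.
apply: nm; constructor => i [im nim]; apply: contrapT => ni.
by apply: nim; apply: wo_anti im (h _ ni).
Qed.

Lemma wo_succ j : (exists k, slt j k) -> exists k, is_succ R j k.
Proof.
move=> /wo_min [k jk h]; exists k; split=> // l jl njl.
exact: h.
Qed.

Section Successor.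
Variables (X : Type) (iX : emb nat X).
Hypothesis nJ : ~ ([set: J] #<= [set: X]).
Hypothesis segJ : forall j, [set i | R i j /\ i <> j] #<= [set: X].

(** Regularity of the successor cardinal: an unbounded family indexed by at most [X] would make [J]
    a union of at most [X] initial segments of size at most [X]. *)
Lemma succ_card_bounded (I : Type) (f : I -> J) :
  emb I X -> exists j, forall i, R (f i) j.
Proof.
move=> hI; apply: contrapT => n; apply: nJ.
apply: card_le_trans (card_le_bigcup iX hI (fun i => segJ (f i))).
apply: subset_card_le => j _; apply: contrapT => nj; apply: n; exists j => i.
by apply: not_slt => h; apply: nj; exists i.
Qed.

(** If [j] were last, [J] would be one segment plus a point, of size at most [X]. *)
Lemma succ_card_succ j : exists k, is_succ R j k.
Proof.
apply: wo_succ; apply: contrapT => n; apply: nJ.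
have h : [set j] #<= [set: X] by apply: card_le_finite_set.
apply: card_le_trans (card_leU iX (segJ j) h).
apply: subset_card_le => i _; case: (slt_total i j) => [|->|ji]; first by left.
  by right.
by case: n; exists i.
Qed.

End Successor.
End WellOrder.

Lemma ex_well_order X : exists R : rel X, wochoice.well_order R.
Proof. by elim/Peq: X => X; have [R h] := wochoice.well_ordering_principle X; exists R. Qed.

(** * Formulas and definable sets *)

Section Tuples.
Variable D : Type.

Lemma tcat_lshift k m (a : 'I_k -> D) (b : 'I_m -> D) i : tcat a b (lshift m i) = a i.
Proof. by rewrite /tcat; case: split_ordP => j /eqP; rewrite ?eq_shift // => /eqP ->. Qed.

Lemma tcat_rshift k m (a : 'I_k -> D) (b : 'I_m -> D) i : tcat a b (rshift k i) = b i.
Proof. by rewrite /tcat; case: split_ordP => j /eqP; rewrite ?eq_shift // => /eqP ->. Qed.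

Lemma tcons_ord0 k x (v : 'I_k -> D) : tcons x v ord0 = x.
Proof. by rewrite /tcons unlift_none. Qed.

Lemma tcons_lift k x (v : 'I_k -> D) i : tcons x v (lift ord0 i) = v i.
Proof. by rewrite /tcons liftK. Qed.

Lemma tcons_tcat k m x (a : 'I_k -> D) (b : 'I_m -> D) :
  tcons x (tcat a b) = tcat (tcons x a) b.
Proof.
apply/funext => i; case: (split_ordP (i : 'I_(k.+1 + m))) => j ->; last first.
  rewrite tcat_rshift; have -> : rshift k.+1 j = lift ord0 (rshift k j) by apply: val_inj.
  by rewrite tcons_lift tcat_rshift.
rewrite tcat_lshift; case: (unliftP ord0 j) => [l|] ->.
  have -> : lshift m (lift ord0 l) = lift ord0 (lshift m l) by apply: val_inj.
  by rewrite !tcons_lift tcat_lshift.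
have -> : lshift m (ord0 : 'I_k.+1) = ord0 by apply: val_inj.
by rewrite !tcons_ord0.
Qed.

Lemma tcons_eta k (v : 'I_k.+1 -> D) : tcons (v ord0) (v \o lift ord0) = v.
Proof.
by apply/funext => i; case: (unliftP ord0 i) => [j|] ->; rewrite ?tcons_lift ?tcons_ord0.
Qed.

Lemma tcat_all (B : set D) k m (a : 'I_k -> D) (b : 'I_m -> D) :
  (forall i, B (a i)) -> (forall i, B (b i)) -> forall i, B (tcat a b i).
Proof. by move=> ha hb i; case: (split_ordP i) => j ->; rewrite ?tcat_lshift ?tcat_rshift. Qed.

Lemma tcat_comp_l k m (a : 'I_k -> D) (b : 'I_m -> D) : tcat a b \o lshift m = a.
Proof. by apply/funext => i /=; rewrite tcat_lshift. Qed.

Lemma tcat_comp_r k m (a : 'I_k -> D) (b : 'I_m -> D) : tcat a b \o @rshift k m = b.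
Proof. by apply/funext => i /=; rewrite tcat_rshift. Qed.

Lemma tcat0 k (b : 'I_0 -> D) (v : 'I_k -> D) : tcat b v = v.
Proof.
rewrite -[RHS](tcat_comp_r b v); apply/funext => i /=.
by congr (tcat b v _); apply: val_inj.
Qed.

Lemma tcat1 k (b : 'I_1 -> D) (v : 'I_k -> D) : tcat b v = tcons (b ord0) v.
Proof. by have := tcons_tcat (b ord0) (b \o lift ord0) v; rewrite tcat0 tcons_eta => ->. Qed.

End Tuples.

Lemma comp_tcat (D D' : Type) (f : D -> D') k m (a : 'I_k -> D) (b : 'I_m -> D) :
  f \o tcat a b = tcat (f \o a) (f \o b).
Proof.
by apply/funext => i; case: (split_ordP i) => j ->; rewrite /= !(tcat_lshift, tcat_rshift).
Qed.

Lemma comp_tcons (D D' : Type) (f : D -> D') k x (a : 'I_k -> D) :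
  f \o tcons x a = tcons (f x) (f \o a).
Proof.
by apply/funext => i; case: (unliftP ord0 i) => [j|] ->; rewrite /= !(tcons_lift, tcons_ord0).
Qed.

Section Renaming.
Variable L : language.

Fixpoint term_ren k l (r : 'I_k -> 'I_l) (t : term L k) : term L l :=
  match t with
  | TVar i => TVar L (r i)
  | TApp f ts => TApp (fun i => term_ren r (ts i))
  end.

Fixpoint formula_ren k l (r : 'I_k -> 'I_l) (phi : formula L k) : formula L l :=
  match phi with
  | FEq t u => FEq (term_ren r t) (term_ren r u)
  | FRel s ts => FRel (fun i => term_ren r (ts i))
  | FNot psi => FNot (formula_ren r psi)
  | FAnd psi chi => FAnd (formula_ren r psi) (formula_ren r chi)
  | FEx psi => FEx (formula_ren (tcons ord0 (lift ord0 \o r)) psi)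
  end.

Variables (D : Type) (S : structure L D).

Lemma teval_ren k l (r : 'I_k -> 'I_l) (t : term L k) v :
  teval S v (term_ren r t) = teval S (v \o r) t.
Proof. by elim: t => //= f ts IH; congr ifun; apply/funext => i. Qed.

Lemma sat_ren k (phi : formula L k) l (r : 'I_k -> 'I_l) v :
  sat S (formula_ren r phi) v <-> sat S phi (v \o r).
Proof.
elim: phi l r v => {k} [k t u|k s ts|k psi IH|k psi IH chi IH'|k psi IH] l r v /=.
- by rewrite !teval_ren.
- suff -> : (fun i => teval S v (term_ren r (ts i))) = (fun i => teval S (v \o r) (ts i)) by [].
  by apply/funext => i; rewrite teval_ren.
- by rewrite IH.
- by rewrite IH IH'.
- by split=> -[x h]; exists x; move: h; rewrite IH comp_tcons tcons_ord0;
    (have -> : tcons x v \o (lift ord0 \o r) = v \o r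
      by apply/funext => i /=; rewrite tcons_lift).
Qed.

Lemma automorphism_teval sigma : automorphism S sigma ->
  forall k (t : term L k) v, teval S (sigma \o v) t = sigma (teval S v t).
Proof.
move=> [_ hf _] k t v; elim: t => //= f ts IH; rewrite hf.
by congr ifun; apply/funext => i /=.
Qed.

Lemma automorphism_sat sigma : automorphism S sigma ->
  forall k (phi : formula L k) v, sat S phi (sigma \o v) <-> sat S phi v.
Proof.
move=> aut k phi; have [[tau tauK sigmaK] hf hr] := aut.
elim: phi => {k} [k t u|k s ts|k psi IH|k psi IH chi IH'|k psi IH] v /=.
- rewrite !(automorphism_teval aut); split=> [|-> //].
  exact: (can_inj tauK).
- rewrite -(hr s (fun i => teval S v (ts i))); suff -> : (fun i => teval S (sigma \o v) (ts i)) =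
    sigma \o (fun i => teval S v (ts i)) by [].
  by apply/funext => i; rewrite (automorphism_teval aut).
- by rewrite IH.
- by rewrite IH IH'.
- split=> [[x h]|[x h]].
    by exists (tau x); rewrite -IH comp_tcons sigmaK.
  by exists (sigma x); rewrite -comp_tcons IH.
Qed.

Lemma automorphism_inv sigma tau : automorphism S sigma ->
  cancel sigma tau -> cancel tau sigma -> automorphism S tau.
Proof.
move=> [_ hf hr] sK tK; split=> [|f v|r v]; first by exists sigma.
  apply: (can_inj sK); rewrite tK hf; congr ifun; apply/funext => i /=; by rewrite tK.
rewrite -hr; suff -> : sigma \o (tau \o v) = v by [].
by apply/funext => i /=.
Qed.

End Renaming.

(** * Unique readability and the number of formulas *)

Section CountFormulas.
Variable L : language.
Let tok := lang_card L.

(** Polish notation; variables are shifted by 4 because the numbers 0 to 3 mark equality, the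
    connectives and the quantifier in [formula_code]. *)
Fixpoint term_code k (t : term L k) : seq tok :=
  match t with
  | TVar i => [:: inr (i + 4)]
  | TApp f ts => inl (inl f) :: flatten [seq term_code (ts i) | i <- enum 'I_(far f)]
  end.

Fixpoint formula_code k (phi : formula L k) : seq tok :=
  match phi with
  | FEq t u => inr 0 :: term_code t ++ term_code u
  | FRel r ts => inl (inr r) :: flatten [seq term_code (ts i) | i <- enum 'I_(rar r)]
  | FNot psi => inr 1 :: formula_code psi
  | FAnd psi chi => inr 2 :: formula_code psi ++ formula_code chi
  | FEx psi => inr 3 :: formula_code psi
  end.

(** Unique readability is proved with arbitrary remainders [s] and [s'], so that after one argument
    is read the next can be peeled off. *)
Lemma flatten_code_inj k (I : eqType) (r : seq I) (ts ts' : I -> term L k) s s' :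
  (forall i t' s s', term_code (ts i) ++ s = term_code t' ++ s' -> ts i = t' /\ s = s') ->
  flatten [seq term_code (ts i) | i <- r] ++ s = flatten [seq term_code (ts' i) | i <- r] ++ s' ->
  {in r, ts =1 ts'} /\ s = s'.
Proof.
move=> IH; elim: r => [|x r IHr] //=; rewrite -!catA => /IH [e /IHr [h ->]].
by split=> // i; rewrite inE => /orP [/eqP ->|/h].
Qed.

Lemma term_code_inj k (t t' : term L k) s s' :
  term_code t ++ s = term_code t' ++ s' -> t = t' /\ s = s'.
Proof.
elim: t t' s s' => [i|f ts IH] [j|g us] s s' //=.
  by case=> /addIn /val_inj -> ->.
move=> [E]; subst g => /(flatten_code_inj IH) [h ->]; split=> //.
by congr TApp; apply/funext => i; apply: h; rewrite mem_enum.
Qed.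

Lemma formula_code_inj k (phi phi' : formula L k) s s' :
  formula_code phi ++ s = formula_code phi' ++ s' -> phi = phi' /\ s = s'.
Proof.
elim: phi phi' s s' => {k} [k t u|k r ts|k psi IH|k psi IH chi IH'|k psi IH]
  [t' u'|r' ts'|psi'|psi' chi'|psi'] s s' //=; rewrite -?catA.
- by move=> [] /term_code_inj [-> /term_code_inj [-> ->]].
- move=> [E]; subst r' => /(flatten_code_inj (fun i => @term_code_inj _ (ts i))) [h ->].
  by split=> //; congr FRel; apply/funext => i; apply: h; rewrite mem_enum.
- by move=> [] /IH [-> ->].
- by move=> [] /IH [-> /IH' [-> ->]].
- by move=> [] /IH [-> ->].
Qed.

Lemma emb_nat_lang_card : emb nat (lang_card L).
Proof. by exists inr => i j []. Qed.

Lemma emb_formula k : emb (formula L k) (lang_card L).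
Proof.
apply: emb_trans (emb_seq emb_nat_lang_card (emb_refl _)).
exists (@formula_code k) => phi phi' E.
by have [] := @formula_code_inj _ phi phi' [::] [::]; rewrite ?cats0.
Qed.

End CountFormulas.

(** * Filters *)

(** The filter generated by [F], as an inductive closure: compactness arguments become inductions on
    a derivation. *)
Inductive fgen (E : Type) (F : set (set E)) : set (set E) :=
| fgenT : fgen F setT
| fgen_in P : F P -> fgen F P
| fgenI P Q : fgen F P -> fgen F Q -> fgen F (P `&` Q)
| fgenS P Q : P `<=` Q -> fgen F P -> fgen F Q.

Section Fgen.
Variable E : Type.
Implicit Types F G : set (set E).

#[local] Instance fgen_filter F : Filter (fgen F).
Proof. by split; [exact: fgenT|exact: fgenI|exact: fgenS]. Qed.

Lemma fgen_min F G : Filter G -> F `<=` G -> fgen F `<=` G.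
Proof.
move=> fG FG P; elim=> {P} [|P /FG //|P Q _ GP _ GQ|P Q PQ _]; last exact: filterS.
- exact: filterT.
- exact: filterI.
Qed.

Lemma fgen_mono F G : F `<=` G -> fgen F `<=` fgen G.
Proof. by move=> FG; apply: fgen_min => P /FG; apply: fgen_in. Qed.

Lemma filter_ultra G : Filter G -> ~ G set0 -> exists U, UltraFilter U /\ G `<=` U.
Proof. by move=> fG n; apply: ultraFilterLemma; split. Qed.

Lemma fgen_ultra F : ~ fgen F set0 -> exists U, UltraFilter U /\ F `<=` U.
Proof.
move=> /(filter_ultra _) [U [uU FU]]; exists U; split=> // P FP.
exact/FU/fgen_in.
Qed.

Lemma ultra_notin (U : set (set E)) P : UltraFilter U -> U P -> ~ U (~` P).
Proof.
move=> uU UP UnP; apply: (@filter_not_empty _ U); rewrite -(setICr P).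
exact: filterI.
Qed.

Lemma ultraC (U : set (set E)) P : UltraFilter U -> ~ U P -> U (~` P).
Proof. by move=> uU; have [|//] := in_ultra_setVsetC P uU. Qed.

Lemma filter_finite_bigcap (I : Type) (A : set I) (X : I -> set E) (G : set (set E)) :
  Filter G -> finite_set A -> (forall i, A i -> G (X i)) -> G (\bigcap_(i in A) X i).
Proof.
elim/Pchoice: I => I in A X *; move=> fG /finite_fsetP [s ->] h.
by apply: filter_bigI.
Qed.

Lemma filter_notin_ultra G P : Filter G -> ~ G P ->
  exists U, [/\ UltraFilter U, G `<=` U & ~ U P].
Proof.
move=> fG n.
(* This is the filter generated by [G] and the complement of [P]; it is proper because [P] is not in
   [G]. *)
have [||U [uU GU]] := @filter_ultra [set Q | G (Q `|` P)].
- split=> [|Q Q' GQ GQ'|Q Q' QQ' GQ] /=; first by rewrite setTU; apply: filterT.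
    by rewrite setUIl; apply: filterI.
  by apply: (@filterS _ G _ _ _ _ GQ) => x [/QQ'|]; [left|right].
- by rewrite /= set0U.
exists U; split=> // [Q GQ|UP]; first by apply: GU; apply: (@filterS _ G _ _ _ _ GQ); left.
by apply: (ultra_notin uU UP); apply: GU; rewrite /= setUC setUv; apply: filterT.
Qed.

End Fgen.

(** * Definable sets and the monster model *)

Arguments pf_par {L D n} p _.

Section Definable.
Variables (L : language) (D : Type) (S : structure L D).

Definition dset k (psi : pformula L D k) : set ('I_k -> D) := [set a | pf_sat S a psi].

Definition dfn (B : set D) k (X : set ('I_k -> D)) : Prop :=
  exists2 psi : pformula L D k, pf_over B psi & X = dset psi.

Lemma dfn_dset (B : set D) k (psi : pformula L D k) : pf_over B psi -> dfn B (dset psi).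
Proof. by exists psi. Qed.

Lemma dfn_mono (A B : set D) k (X : set ('I_k -> D)) : A `<=` B -> dfn A X -> dfn B X.
Proof. by move=> AB [psi o ->]; exists psi => // i; apply/AB/o. Qed.

Lemma dfn_sat B k (phi : formula L k) : dfn B [set v | sat S phi v].
Proof.
have e : 'I_0 -> D by case.
exists (PFormula (formula_ren (lshift 0) phi) e); first by case.
by apply/predeqP => v; rewrite /dset /pf_sat /= sat_ren tcat_comp_l.
Qed.

Lemma dfnT B k : dfn B (setT : set ('I_k -> D)).
Proof.
(* Truth is written as the existence of some [x = x], which also makes sense when [k] is 0. *)
have := dfn_sat B (FEx (FEq (TVar L (ord0 : 'I_k.+1)) (TVar L ord0))).
congr dfn; apply/predeqP => v; split=> // _ /=.
by have [x] := dom_inh S; exists x.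
Qed.

Lemma dfnC B k (X : set ('I_k -> D)) : dfn B X -> dfn B (~` X).
Proof. by move=> [psi o ->]; exists (pf_neg psi). Qed.

Definition pf_and k (psi chi : pformula L D k) : pformula L D k :=
  PFormula (FAnd
    (formula_ren (tcat (lshift _) (@rshift k _ \o lshift _)) (pf_fml psi))
    (formula_ren (tcat (lshift _) (@rshift k _ \o @rshift _ _)) (pf_fml chi)))
    (tcat (pf_par psi) (pf_par chi)).

Lemma pf_and_over B k (psi chi : pformula L D k) :
  pf_over B psi -> pf_over B chi -> pf_over B (pf_and psi chi).
Proof. exact: tcat_all. Qed.

Lemma dset_and k (psi chi : pformula L D k) : dset (pf_and psi chi) = dset psi `&` dset chi.
Proof.
case: psi chi => [m phi c] [m' phi' c'].
apply/predeqP => v; rewrite /dset /pf_and /pf_sat /= !sat_ren !comp_tcat !compA.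
by rewrite !tcat_comp_l !tcat_comp_r !tcat_comp_l.
Qed.

Lemma dfnI B k (X Y : set ('I_k -> D)) : dfn B X -> dfn B Y -> dfn B (X `&` Y).
Proof.
move=> [psi o ->] [chi o' ->]; exists (pf_and psi chi); first exact: pf_and_over.
by rewrite dset_and.
Qed.

Lemma dfn_ren B k l (r : 'I_k -> 'I_l) (X : set ('I_k -> D)) :
  dfn B X -> dfn B [set v : 'I_l -> D | X (v \o r)].
Proof.
move=> [[m phi c] o ->].
exists (PFormula (formula_ren (tcat (lshift m \o r) (@rshift l m)) phi) c) => //.
apply/predeqP => v; rewrite /dset /pf_sat /= sat_ren comp_tcat compA.
by rewrite tcat_comp_l tcat_comp_r.
Qed.

Lemma dfn_ex1 B k (X : set ('I_k.+1 -> D)) :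
  dfn B X -> dfn B [set v | exists x, X (tcons x v)].
Proof.
move=> [[m phi c] o ->]; exists (PFormula (n := k) (pf_len := m) (FEx (phi : formula L (k + m).+1)) c) => //.
apply/predeqP => v; rewrite /dset /pf_sat /=.
by split=> -[x h]; exists x; rewrite tcons_tcat in h *.
Qed.

Lemma dfn_ex B k m (X : set ('I_(m + k) -> D)) :
  dfn B X -> dfn B [set v | exists b : 'I_m -> D, X (tcat b v)].
Proof.
elim: m X => [|m IH] X dX.
  suff -> : [set v | exists b : 'I_0 -> D, X (tcat b v)] = X by [].
  apply/predeqP => v; split=> [[b]|Xv]; first by rewrite tcat0.
  have e : 'I_0 -> D by case.
  by exists e; rewrite tcat0.
have := IH _ (dfn_ex1 (k := m + k) dX).
congr dfn; apply/predeqP => v; split=> [[b [x h]]|[b h]].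
  by exists (tcons x b); rewrite -tcons_tcat.
by exists (b \o lift ord0), (b ord0); rewrite tcons_tcat tcons_eta.
Qed.

Lemma dfn_par B k m (X : set ('I_(k + m) -> D)) (c : 'I_m -> D) :
  (forall i, B (c i)) -> dfn B X -> dfn B [set v | X (tcat v c)].
Proof.
move=> Bc [[j phi d] o ->].
exists (PFormula (formula_ren
  (tcat (tcat (lshift (m + j)) (@rshift k (m + j) \o lshift j)) (@rshift k (m + j) \o @rshift m j)) phi)
  (tcat c d)); first exact: tcat_all.
apply/predeqP => v; rewrite /dset /pf_sat /= sat_ren !comp_tcat !compA.
by rewrite !tcat_comp_l !tcat_comp_r !tcat_comp_l.
Qed.

Definition utype k (U : set (set ('I_k -> D))) (B : set D) : set (pformula L D k) :=
  [set psi | pf_over B psi /\ U (dset psi)].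

Lemma utype_complete k (U : set (set ('I_k -> D))) B :
  UltraFilter U -> complete_type S B (utype U B).
Proof.
move=> uU; split=> [|psi o].
  split=> [psi []//|F fF FU].
  have UF : U (\bigcap_(psi in F) dset psi).
    by apply: filter_finite_bigcap => // psi /FU [].
  by have [a ha] := filter_ex UF; exists a => psi /ha.
have [|n] := EM (U (dset psi)); first by left.
by right; split=> //; apply: ultraC.
Qed.

Lemma complete_tp k (a : 'I_k -> D) B : complete_type S B (tp S a B).
Proof.
split=> [|psi o].
  by split=> [psi []//|F _ Fa]; exists a => psi /Fa [].
by have [h|h] := EM (pf_sat S a psi); [left|right].
Qed.

Lemma complete_type_eq k (a : 'I_k -> D) B q :
  complete_type S B q -> realizes S a q -> q = tp S a B.
Proof.
move=> [[qo _] qc] aq; apply/predeqP => psi; split=> [qpsi|[o h]].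
  by split; [apply: qo|apply: aq].
by have [//|/aq] := qc psi o.
Qed.

Lemma complete_type_consistent k B (q : set (pformula L D k)) psi :
  complete_type S B q -> q psi -> ~ q (pf_neg psi).
Proof.
move=> [[_ qf] _] qp qn; have [|psi' [|] ->//|a ha] := qf [set psi; pf_neg psi].
  exact: finite_set2.
by have /(_ (ha psi (or_introl erefl))) := ha (pf_neg psi) (or_intror erefl).
Qed.

Section Monster.
Variables (T : set (sentence L)) (K : Type) (hD : monster_model S T K).
Local Notation small := (is_small K).

(** Compactness: the family extends to an ultrafilter, whose complete type over [B] is realized by
    saturation. *)
Lemma monster_fip k (B : set D) (F : set (set ('I_k -> D))) :
  small B -> (forall X, F X -> dfn B X) -> ~ fgen F set0 ->
  exists b, forall X, F X -> X b.
Proof.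
move=> sB dF /fgen_ultra [U [uU FU]].
have [//|b _ hb] := monster_saturated hD _ sB (utype_complete B uU).
by exists b => X FX; have [psi o E] := dF X FX; rewrite E; apply: hb; split=> //; rewrite -E; apply: FU.
Qed.

Lemma small_le (A B : set D) : A #<= B -> small B -> small A.
Proof.
move=> AB [h n]; split; first exact: card_le_trans AB h.
by move=> h'; apply: n; apply: card_le_trans h' AB.
Qed.

Lemma small_sub (A B : set D) : A `<=` B -> small B -> small A.
Proof. by move=> /subset_card_le; exact: small_le. Qed.

Lemma small_leT (X : Type) (A : set D) :
  A #<= [set: X] -> card_lt [set: X] [set: K] -> small A.
Proof.
move=> AB [h n]; split; first exact: card_le_trans AB h.
by move=> h'; apply: n; apply: card_le_trans h' AB.
Qed.

Lemma emb_lt (X Y : Type) : emb X Y -> card_lt [set: Y] [set: K] -> card_lt [set: X] [set: K].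
Proof.
move=> /card_le_embE AB [h n]; split; first exact: card_le_trans AB h.
by move=> h'; apply: n; apply: card_le_trans h' AB.
Qed.

Lemma small_type (A : set D) : small A -> card_lt [set: A] [set: K].
Proof.
move=> [/card_le_emb h n]; split; first exact/card_le_embE.
move=> /card_le_embE h'; apply: n; apply/card_leP_emb.
exact: emb_trans (emb_setT K).2 h'.
Qed.

Lemma card_lt_sum X Y : card_lt [set: X] [set: K] -> card_lt [set: Y] [set: K] ->
  emb nat Y -> card_lt [set: (X + Y)%type] [set: K].
Proof.
move=> hX hY iY; have [XY|YX] := emb_total X Y.
  exact: emb_lt (emb_sum_le iY XY (emb_refl Y)) hY.
exact: emb_lt (emb_sum_le (emb_trans iY YX) (emb_refl X) YX) hX.
Qed.

Lemma small_setU (A B : set D) : small A -> small B -> small (A `|` B).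
Proof.
move=> hA hB; have hN : card_lt [set: lang_card L] [set: K] := monster_large hD.
have iN := emb_nat_lang_card L.
have h1 := card_lt_sum (small_type hA) hN iN.
have i1 : emb nat (A + lang_card L) by apply: emb_trans iN _; exists inr => i j [].
have i2 : emb nat (B + (A + lang_card L)) by apply: emb_trans i1 _; exists inr => i j [].
apply: small_leT (card_lt_sum (small_type hB) h1 i1).
by apply: (card_leU i2); apply/card_le_emb; [ exists (fun a => inr (inl a)) => a b []|exists inl => a b []].
Qed.

Lemma small_finite (A : set D) : finite_set A -> small A.
Proof.
move=> fA; apply: small_leT (monster_large hD).
exact: (card_le_finite_set (emb_nat_lang_card L) fA).
Qed.

(** Strong homogeneity speaks of maps; the map used is the identity on [N] and sends [b i] to [c i],
    consistently because types over [N] record equalities. *)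
Lemma monster_homog (N : set D) m (b c : 'I_m -> D) : small N -> N !=set0 ->
  tp S b N `<=` tp S c N ->
  exists sigma, [/\ automorphism S sigma, {in N, sigma =1 id} & sigma \o b = c].
Proof.
move=> sN [x0 N0] hbc.
have tr psi : pf_over N psi -> (pf_sat S b psi <-> pf_sat S c psi).
  move=> o; split=> [h|h]; first by have [] := hbc psi (conj o h).
  apply: contrapT => n; have [] : tp S c N (pf_neg psi) by apply: hbc.
  by move=> _; apply.
have /choice [f fP] (x : D) : exists y, (N x -> y = x) /\ forall i, b i = x -> y = c i.
  have [Nx|nx] := EM (N x).
    exists x; split=> // i E.
    have /tr h : pf_over N (PFormula (pf_len := 1) (FEq (TVar L (lshift 1 i)) (TVar L (rshift m ord0))) (fun=> x)) by [].
    by move: h; rewrite /pf_sat /= !tcat_lshift !tcat_rshift => -[/(_ E) ->].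
  have [[i E]|n] := EM (exists i, b i = x); last by exists x; split=> // i E; case: n; exists i.
  exists (c i); split=> // j E'.
  have /tr h : pf_over N (PFormula (pf_len := 1) (FEq (TVar L (lshift 1 i)) (TVar L (lshift 1 j))) (fun=> x0)) by [].
  by move: h; rewrite /pf_sat /= !tcat_lshift E E' => -[/(_ erefl)].
pose B := N `|` range b.
have sB : small B.
  apply: small_setU => //; by apply: small_finite; apply: finite_image; apply: finite_finset.
have eB : elementary_on S B f.
  move=> k phi v Bv.
  (* A tuple from [N] and [b] is a reindexing of [b] followed by parameters in [N]; places outside
     [N] get the dummy parameter [x0]. *)
  pose par j := if pselect (N (v j)) then v j else x0.
  have Npar j : N (par j) by rewrite /par; case: pselect.
  have /choice [r rP] (j : 'I_k) : exists i : 'I_(m + k), tcat b par i = v j /\ tcat c par i = f (v j).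
    have [Nv|nN] := EM (N (v j)).
      exists (rshift m j); rewrite !tcat_rshift (fP _).1 //.
      by rewrite /par; case: pselect.
    case: (Bv j) => // -[i _ E]; exists (lshift k i); rewrite !tcat_lshift; split=> //.
    by rewrite ((fP (v j)).2 i).
  have := tr (PFormula (formula_ren r phi) par) Npar; rewrite /pf_sat /= !sat_ren.
  have -> : tcat b par \o r = v by apply/funext => j; exact: (rP j).1.
  by have -> : tcat c par \o r = f \o v by apply/funext => j; exact: (rP j).2.
have [sigma aut E] := monster_homogeneous hD sB eB.
exists sigma; split=> // [x|].
  by rewrite inE => Nx; rewrite E ?(fP x).1 // inE; left.
apply/funext => i /=; rewrite E ?((fP (b i)).2 i) // inE; right; by exists i.
Qed.

End Monster.
End Definable.

(** * Local rank *)

Section FgenMore.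
Variable E : Type.
Implicit Types F : set (set E).

Lemma fgen_setU1 F X P : fgen (F `|` [set X]) P ->
  exists2 P', fgen F P' & P' `&` X `<=` P.
Proof.
elim=> {P} [|P [FP|->]|P Q _ [P' hP sP] _ [Q' hQ sQ]|P Q PQ _ [P' hP sP]].
- by exists setT => //; apply: fgenT.
- by exists P; [apply: fgen_in|move=> x []].
- by exists setT; [apply: fgenT|move=> x []].
- exists (P' `&` Q'); first exact: fgenI.
  by move=> x [[p q] Xx]; split; [apply: sP|apply: sQ].
- by exists P' => //; apply: subset_trans PQ.
Qed.

(** A derivation uses finitely many members of the chain, hence a single one; the first alternative
    covers derivations that use none, as [I] may be empty. *)
Lemma fgen_chain (I : Type) (le : I -> I -> Prop) (G : I -> set (set E)) F P :
  (forall i j, le i j \/ le j i) -> (forall i j, le i j -> G i `<=` G j) ->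
  fgen (F `|` \bigcup_i G i) P -> fgen F P \/ exists i, fgen (F `|` G i) P.
Proof.
move=> tot mono.
have up i Q : fgen F Q -> fgen (F `|` G i) Q by apply: fgen_mono => X; left.
elim=> {P} [|P [FP|[i _ GP]]|P Q _ hP _ hQ|P Q PQ _ [hP|[i hP]]].
- by left; apply: fgenT.
- by left; apply: fgen_in.
- by right; exists i; apply: fgen_in; right.
- case: hP hQ => [hP|[i hP]] [hQ|[j hQ]].
  + by left; apply: fgenI.
  + by right; exists j; apply: fgenI => //; apply: up.
  + by right; exists i; apply: fgenI => //; apply: up.
  + right; have [/mono ij|/mono ji] := tot i j.
      by exists j; apply: fgenI => //; apply: fgen_mono hP => X [|/ij]; [left|right].
    by exists i; apply: fgenI => //; apply: fgen_mono hQ => X [|/ji]; [left|right].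
- by left; apply: fgenS hP.
- by right; exists i; apply: fgenS hP.
Qed.

End FgenMore.

Section Rank.
Variables (L : language) (D : Type) (S : structure L D).
Variables (n m : nat) (phi : formula L (n + m)).
Local Notation E := ('I_n -> D).

Definition inst (b : 'I_m -> D) : set E := [set a | sat S phi (tcat a b)].

(* Shelah's local 2-rank: [rk N P] says that the [phi]-rank of [P] is at
   least [N]. *)
Fixpoint rk (N : nat) (P : set E) : Prop :=
  if N is N'.+1 then exists b, rk N' (P `&` inst b) /\ rk N' (P `&` ~` inst b)
  else P !=set0.

Lemma rk_mono N P Q : P `<=` Q -> rk N P -> rk N Q.
Proof.
elim: N P Q => [|N IH] P Q PQ /=; first by move=> [x /PQ]; exists x.
by move=> [b [h h']]; exists b; split; [apply: IH h|apply: IH h'] => x [/PQ].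
Qed.

Lemma rkS N P : rk N.+1 P -> rk N P.
Proof. by move=> [b [h _]]; apply: rk_mono h => x []. Qed.

Lemma rk_leq N N' P : N <= N' -> rk N' P -> rk N P.
Proof. by move=> /subnK <-; elim: (N' - N) => // k IH /rkS /IH. Qed.

(** Each level of the rank is one more quantifier over [m]-tuples; the parameter block [y] has
    arbitrary length so that it can absorb the tuples quantified at outer levels. *)
Lemma rk_dfn N (B : set D) k (X : set ('I_(n + k) -> D)) :
  dfn S B X -> dfn S B [set y | rk N [set a | X (tcat a y)]].
Proof.
elim: N k X => [|N IH] k X dX; first exact: dfn_ex.
(* Renamings for the variables [(a, b, y)]: [r1] drops [b] and [r2] drops [y]. *)
pose r1 : 'I_(n + k) -> 'I_(n + (m + k)) := tcat (lshift _) (@rshift n _ \o @rshift m k).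
pose r2 : 'I_(n + m) -> 'I_(n + (m + k)) := tcat (lshift _) (@rshift n _ \o lshift k).
have d1 := dfn_ren r1 dX; have d2 := dfn_ren r2 (dfn_sat S B phi).
have := dfn_ex (dfnI (IH _ _ (dfnI d1 d2)) (IH _ _ (dfnI d1 (dfnC d2)))).
congr dfn; apply/predeqP => y.
have e1 a (b : 'I_m -> D) : tcat a (tcat b y) \o r1 = tcat a y.
  by rewrite /r1 comp_tcat compA tcat_comp_l tcat_comp_r tcat_comp_r.
have e2 a (b : 'I_m -> D) : tcat a (tcat b y) \o r2 = tcat a b.
  by rewrite /r2 comp_tcat compA tcat_comp_l tcat_comp_r tcat_comp_l.
clearbody r1 r2.
by split=> -[b [h h']]; exists b; split; [move: h|move: h'|move: h|move: h'];
  apply: rk_mono => a /=; rewrite e1 e2.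
Qed.

Lemma inst_automorphism sigma b a : automorphism S sigma ->
  inst (sigma \o b) (sigma \o a) <-> inst b a.
Proof. by move=> aut; rewrite /inst /= -comp_tcat; apply: automorphism_sat. Qed.

Lemma rk_automorphism sigma N P : automorphism S sigma ->
  rk N [set a | P (sigma \o a)] <-> rk N P.
Proof.
move=> aut; have [[tau sK tK] _ _] := aut.
have K1 k (a : 'I_k -> D) : sigma \o (tau \o a) = a by apply/funext => i /=.
have K2 k (a : 'I_k -> D) : tau \o (sigma \o a) = a by apply/funext => i /=.
have ei b a : inst (sigma \o b) (sigma \o a) <-> inst b a by apply: inst_automorphism.
elim: N P => [|N IH] P /=.
  split=> [[a h]|[a h]]; first by exists (sigma \o a).
  by exists (tau \o a); rewrite /= K1.
split=> [[b [h h']]|[b [h h']]].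
  exists (sigma \o b); split; apply/IH; [move: h|move: h']; apply: rk_mono => a [Pa ia].
    by split=> //; apply/ei.
  by split=> //= /ei.
have ei' a : inst b (sigma \o a) <-> inst (tau \o b) a by rewrite -(ei (tau \o b)) K1.
exists (tau \o b); split; [move: ((IH _).2 h)|move: ((IH _).2 h')]; apply: rk_mono => a [Pa ia].
  by split=> //; apply/ei'.
by split=> //= /ei'.
Qed.

Section Stable.
Variables (T : set (sentence L)) (K : Type) (hD : monster_model S T K).

Let big (Q : set (set E)) := forall N P, fgen Q P -> rk N P.

Lemma fgen_dfn (B : set D) (Q : set (set E)) P :
  (forall X, Q X -> dfn S B X) -> fgen Q P -> exists P', [/\ P' `<=` P, fgen Q P' & dfn S B P'].
Proof.
move=> dQ; elim=> {P} [|P QP|P R _ [P' [sP gP dP]] _ [R' [sR gR dR]]|P R PR _ [P' [sP gP dP]]].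
- by exists setT; split=> //; [apply: fgenT|apply: dfnT].
- by exists P; split=> //; [apply: fgen_in|apply: dQ].
- exists (P' `&` R'); split; [|exact: fgenI|exact: dfnI].
  by move=> x [/sP ? /sR].
- by exists P'; split=> //; apply: subset_trans PR.
Qed.

(** For given [N] and [P], rank at least [N.+1] provides a [b] leaving rank at least [N] on both
    sides. These conditions on [b] are definable and form a directed family, so saturation meets
    them all at once. *)
Lemma big_step (B : set D) (Q : set (set E)) : is_small K B ->
  (forall X, Q X -> dfn S B X) -> big Q ->
  exists b, big (Q `|` [set inst b]) /\ big (Q `|` [set ~` inst b]).
Proof.
move=> sB dQ bQ.
pose Y N P : set ('I_m -> D) := [set b | rk N (P `&` inst b) /\ rk N (P `&` ~` inst b)].
pose F : set (set ('I_m -> D)) := [set Z | exists N P, [/\ fgen Q P, dfn S B P & Z = Y N P]].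
have [||b hb] := monster_fip hD (F := F) sB.
- move=> Z [N [P [_ dP ->]]].
  have d1 : dfn S B [set v : 'I_(n + m) -> D | P (v \o lshift m)] by apply: dfn_ren.
  have d2 := dfn_sat S B phi.
  have := dfnI (rk_dfn N (dfnI d1 d2)) (rk_dfn N (dfnI d1 (dfnC d2))).
  congr dfn; apply/predeqP => b.
  by split=> -[h h']; split; [move: h|move: h'|move: h|move: h']; apply: rk_mono => a /=;
    rewrite tcat_comp_l.
- move=> h; have [N [P [gP]]] : exists N P, fgen Q P /\ Y N P `<=` set0.
    elim: h => {}[|Z [N [P [gP dP ->]]]|Z W _ [N [P [gP sP]]] _ [N' [P' [gP' sP']]]|Z W ZW _ [N [P [gP sP]]]].
    + by exists 0, setT; split=> //; apply: fgenT.
    + by exists N, P; split=> // b.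
    (* Directedness: a larger rank on a smaller set implies both conditions. *)
    + exists (maxn N N'), (P `&` P'); split; first exact: fgenI.
      move=> b [h h']; split; [apply: sP|apply: sP']; split.
      * by apply: rk_leq (leq_maxl _ _) _; apply: rk_mono h => a [[]].
      * by apply: rk_leq (leq_maxl _ _) _; apply: rk_mono h' => a [[]].
      * by apply: rk_leq (leq_maxr _ _) _; apply: rk_mono h => a [[]].
      * by apply: rk_leq (leq_maxr _ _) _; apply: rk_mono h' => a [[]].
    + by exists N, P; split=> //; apply: subset_trans ZW.
  by move=> /(_ _); have [b hb] := bQ N.+1 P gP => /(_ b hb).
exists b; split=> N P /fgen_setU1 [P' gP' sP].
all: have [P'' [s'' g'' d'']] := fgen_dfn dQ gP'.
all: have [h h'] : Y N P'' b by apply: hb; exists N, P''.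
all: by [apply: rk_mono h => a [/s'' ? ?]; apply: sP|apply: rk_mono h' => a [/s'' ? ?]; apply: sP].
Qed.

(** * The binary tree of instances of [phi] *)

Section Tree.
Variables (Lam : Type) (R : rel Lam) (hR : wochoice.well_order R).
Variables (A : set D) (Q0 : set (set E)).
Hypothesis dQ0 : forall X, Q0 X -> dfn S A X.
Hypothesis sA : is_small K A.
Hypothesis sLam : card_lt [set: Lam] [set: K].
Hypothesis iLam : emb nat Lam.
Hypothesis bQ0 : big Q0.

Let sgn (eta : set Lam) i (b : 'I_m -> D) : set E :=
  [set a | inst b a <-> eta i].

Let sgnT (eta : set Lam) i b : eta i -> sgn eta i b = inst b.
Proof. by move=> e; apply/predeqP => a; split=> [[_ /(_ e)]|]. Qed.

Let sgnF (eta : set Lam) i b : ~ eta i -> sgn eta i b = ~` inst b.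
Proof. by move=> e; apply/predeqP => a; split=> [[h _] /h|h]; [apply: e|split=> // /h]. Qed.

(** Making the choice a function of [Q] alone ensures that branches agreeing below a level get the
    same parameter at that level. *)
Lemma ex_pick : exists pick : set (set E) -> ('I_m -> D), forall Q,
  (exists b, big (Q `|` [set inst b]) /\ big (Q `|` [set ~` inst b])) ->
  big (Q `|` [set inst (pick Q)]) /\ big (Q `|` [set ~` inst (pick Q)]).
Proof.
have [d] := dom_inh S.
pose good Q b := big (Q `|` [set inst b]) /\ big (Q `|` [set ~` inst b]).
suff /choice [f fP] Q : exists b, (exists b', good Q b') -> good Q b by exists f.
by have [[b h]|h] := EM (exists b, good Q b); [exists b|exists (fun=> d)].
Qed.

(** Recursion along a branch [eta]: the conditions collected below level [l] still have infinite
    rank by finite character, and [big_step] supplies a parameter for which either sign keeps the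
    rank infinite. *)
Lemma ex_tree : exists b : set Lam -> Lam -> ('I_m -> D),
  (forall eta eta' l, (forall i, slt R i l -> (eta i <-> eta' i)) -> b eta l = b eta' l) /\
  forall eta, big (Q0 `|` \bigcup_i [set sgn eta i (b eta i)]).
Proof.
have [pick hpick] := ex_pick.
pose step eta l (rec : forall i, slt R i l -> ('I_m -> D)) :=
  pick (Q0 `|` [set X | exists i (h : slt R i l), X = sgn eta i (rec i h)]).
pose b eta := Fix (slt_wf hR) (fun=> 'I_m -> D) (step eta).
have bE eta l : b eta l = pick (Q0 `|` [set X | exists2 i, slt R i l & X = sgn eta i (b eta i)]).
  rewrite /b Fix_eq => [|x f g fg].
    congr pick; congr setU; apply/predeqP => X; split=> [[i [h ->]]|[i h ->]].
      by exists i.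
    by exists i, h.
  by congr step; apply/functional_extensionality_dep => y; apply/funext => h; rewrite fg.
exists b; split=> [eta eta' l|eta].
  elim/(well_founded_ind (slt_wf hR)): l => l IH h.
  have e i : slt R i l -> sgn eta i (b eta i) = sgn eta' i (b eta' i).
    move=> il; rewrite (IH i il) => [|j ji]; last by apply: h; apply: slt_trans ji il.
    by rewrite /sgn (propext (h i il)).
  rewrite !bE; congr pick; congr setU; apply/predeqP => X.
  by split=> -[i il ->]; exists i => //; rewrite e.
pose G l := [set X | exists2 i, R i l & X = sgn eta i (b eta i)].
have Gm i j : R i j -> G i `<=` G j.
  by move=> ij X [k ki ->]; exists k => //; apply: wo_trans ki ij.
have bG l : big (Q0 `|` G l).
  elim/(well_founded_ind (slt_wf hR)): l => l IH.
  pose Q := Q0 `|` [set X | exists2 i, slt R i l & X = sgn eta i (b eta i)].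
  have bQ : big Q.
    move=> N P gP.
    pose I := {i | slt R i l}.
    have [] := @fgen_chain _ I (fun i j => R (sval i) (sval j)) (fun i => G (sval i)) Q0 P.
    - by move=> i j; apply: wo_total.
    - by move=> i j; apply: Gm.
    - apply: fgen_mono gP => X [|[i il ->]]; first by left.
      by right; exists (exist _ i il) => //; exists i => //; apply: wo_refl.
    - exact: bQ0.
    - by move=> [[i il]]; apply: IH.
  pose B := A `|` \bigcup_i \bigcup_k [set b eta i k].
  have sB : is_small K B.
    apply: (small_setU hD) => //; apply: small_leT sLam.
    apply: card_le_trans_emb (emb_prod_le iLam (emb_refl Lam) (emb_ord m iLam)).
    apply: (@card_le_range _ _ _ (fun p : Lam * 'I_m => b eta p.1 p.2)) => x [i _ [k _ ->]].
    by exists (i, k).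
  have dQ X : Q X -> dfn S B X.
    move=> [/dQ0|[i il ->]]; first by apply: dfn_mono => x; left.
    have d : dfn S B (inst (b eta i)).
      by apply: dfn_par (dfn_sat S B phi) => k; right; exists i => //; exists k.
    by have [e|e] := EM (eta i); [rewrite sgnT|rewrite sgnF //; apply: dfnC].
  have [h h'] := hpick _ (big_step sB dQ bQ).
  have : big (Q `|` [set sgn eta l (b eta l)]).
    by have [e|e] := EM (eta l); [rewrite (sgnT _ e)|rewrite (sgnF _ e)]; rewrite bE.
  move=> hb N P gP; apply: hb; apply: fgen_mono gP => X [h0|[i il ->]].
    by left; left.
  have [->|n'] := EM (i = l); first by right.
  by left; right; exists i.
move=> N P gP.
have [] := @fgen_chain _ Lam R G Q0 P (wo_total hR) Gm; last 2 first.
- exact: bQ0.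
- by move=> [i]; apply: bG.
apply: fgen_mono gP => X [|[i _ ->]]; first by left.
by right; exists i => //; exists i => //; apply: wo_refl.
Qed.

End Tree.

(** Otherwise there is a full binary tree with levels in [Lam]. Keeping only the levels with at most
    [Lam] nodes leaves at most [Lam] parameters but more than [Lam] branches, and distinct branches
    give distinct types, against stability. *)
Lemma stable_rk (A : set D) (p : set (pformula L D n)) :
  is_small K A -> p `<=` @pf_over L D A n -> stable S K A p ->
  exists N P, fgen [set X | exists2 psi, p psi & X = dset S psi] P /\ ~ rk N P.
Proof.
move=> sA pA [Lam [sLam AL stL]]; set Q0 := [set X | _].
apply: contrapT => nb.
have bQ0 : big Q0 by move=> N P gP; apply: contrapT => nr; apply: nb; exists N, P.
have iLam : emb nat Lam.
  move/card_le_embE: AL; apply: emb_trans; apply: emb_trans (emb_nat_lang_card L) _.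
  by exists inr => i j [].
have ALam : A #<= [set: Lam].
  move/card_le_embE: AL => AL; apply/card_le_emb; apply: emb_trans AL.
  by exists inl => i j [].
have dQ0 X : Q0 X -> dfn S A X by move=> [psi /pA o ->]; apply: dfn_dset.
have [R hR] := ex_well_order Lam.
have [b [bext bbig]] := ex_tree hR dQ0 sA sLam iLam bQ0.
(* [M l] bounds by [Lam] the number of nodes at level [l], that is, of subsets of [Lam] cut below
   [l]. *)
pose M l := exists f : set Lam -> Lam, forall eta eta', f eta = f eta' ->
  forall i, slt R i l -> (eta i <-> eta' i).
(* There are more than [Lam] traces on [M]: if [M] is everything this is Cantor's theorem, and
   otherwise a bound would put the least level outside [M] into [M]. *)
have nM : ~ exists f : set Lam -> Lam, forall eta eta', f eta = f eta' ->
    forall i, M i -> (eta i <-> eta' i).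
  move=> [f fP]; have [aM|/existsNP] := EM (forall l, M l).
    apply: (@cantor Lam); exists f => eta eta' E.
    by apply/predeqP => i; exact: (fP _ _ E i (aM i)).
  move=> nM; have [l nl hl] := wo_min hR nM; apply: nl.
  exists f => eta eta' E i il; apply: (fP _ _ E); apply: contrapT => /hl li.
  by have [ri ni] := il; apply: ni; apply: (wo_anti hR).
have Mdown i l : slt R i l -> M l -> M i.
  move=> il [f fP]; exists f => eta eta' E j ji; apply: (fP _ _ E).
  exact: (slt_trans hR) ji il.
pose B := A `|` [set x | exists eta l k, M l /\ x = b eta l k].
have cB : B #<= [set: Lam].
  apply: card_leU => //.
  have iN : emb 'I_m Lam by apply: emb_ord.
  apply: card_le_trans_emb (emb_prod_le iLam (emb_prod_le iLam (emb_refl Lam) (emb_refl Lam)) iN).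
  have /choice [f fP] (l : Lam) : exists f : set Lam -> Lam, M l -> forall eta eta', f eta = f eta' ->
      forall i, slt R i l -> (eta i <-> eta' i).
    by have [[f]|n0] := EM (M l); [exists f|exists (fun=> l)].
  (* A coordinate of a parameter is coded by its level, its node and its position; [bext] makes
     decoding unambiguous. *)
  apply/card_leE_rel; exists (fun y x => exists eta l k, [/\ M l, x = b eta l k & y = (l, f l eta, k)]).
    move=> y x x' [eta [l [k [Ml -> ->]]]] [eta' [l' [k' [_ -> [E]]]]]; subst l'.
    by move=> E ->; rewrite (bext _ _ _ (fP l Ml _ _ E)).
  by move=> x [eta [l [k [Ml ->]]]]; exists (l, f l eta, k), eta, l, k.
have AB : A `<=` B by move=> x; left.
have /card_le_emb [code codeI] := stL B AB cB.
(* [t eta] completes over [B] the type [p] together with the signs that [eta] prescribes at the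
   levels in [M]. *)
have /choice [t tP] (eta : set Lam) : exists t, [/\ complete_type S B t, p `<=` t &
    forall i, M i -> forall psi, pf_over B psi -> [set a | inst (b eta i) a <-> eta i] `<=` dset S psi -> t psi].
  have [|U [uU QU]] := @fgen_ultra _ (Q0 `|` \bigcup_i [set [set a | inst (b eta i) a <-> eta i]]).
    by move=> g; have [] := bbig eta 0 set0 g.
  exists (utype S U B); split; first exact: utype_complete.
    move=> psi ppsi; split; first by move=> i; apply/AB/pA.
    by apply: QU; left; exists psi.
  move=> i Mi psi o s; split=> //; apply: (@filterS _ U _ _ _ s).
  by apply: QU; right; exists i.
have tin eta : t eta \in [set q | complete_type S B q /\ p `<=` q].
  by apply/mem_set; have [] := tP eta.
apply: nM; exists (fun eta => code (exist _ (t eta) (tin eta))) => eta eta' /codeI [E].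
(* By induction the two branches agree below [i], hence share the parameter at [i]; one type cannot
   contain both signs there. *)
elim/(well_founded_ind (slt_wf hR)) => i IH Mi.
have e : b eta i = b eta' i by apply: bext => j ji; apply: IH => //; apply: Mdown ji Mi.
pose psi := PFormula phi (b eta i).
have opsi : pf_over B psi by move=> k; right; exists eta, i, k.
have [ct _ h] := tP eta; have [_ _ h'] := tP eta'.
have {}h := h i Mi; have {}h' := h' i Mi; rewrite -E -e in h'.
have c := complete_type_consistent ct (psi := psi).
split=> hi; apply: contrapT => ni; apply: c.
- by apply: h => // a [_ /(_ hi)].
- by apply: h' => // a [h1 _] /h1.
- by apply: h' => // a [_ /(_ hi)].
- by apply: h => // a [h1 _] /h1.
Qed.

End Stable.
End Rank.

(** * Lascar equivalence and invariant equivalence relations *)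

Section Lascar.
Variables (L : language) (D : Type) (S : structure L D).
Variables (T : set (sentence L)) (K : Type) (hD : monster_model S T K).

Lemma elementary_submodel_witness (N : set D) k m (phi : formula L (m + k)) (c : 'I_k -> D) :
  elementary_submodel S N -> (forall i, N (c i)) -> (exists b, sat S phi (tcat b c)) ->
  exists2 b, (forall i, N (b i)) & sat S phi (tcat b c).
Proof.
move=> [SN eN] Nc; elim: m phi => [|m IH] phi [b h]; first by exists b => // -[].
have [|b' Nb' [x0 h0]] := IH (FEx (phi : formula L (m + k).+1)).
  by exists (b \o lift ord0), (b ord0); rewrite tcons_tcat tcons_eta.
have Nv i : N (tcat b' c i) by apply: tcat_all.
pose v i : N := SigSub (mem_set (Nv i)).
have [x hx] : sat SN (FEx (phi : formula L (m + k).+1)) v by apply/eN; exists x0.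
exists (tcons (val x) b') => [i|].
  case: (unliftP ord0 i) => [j|] ->; rewrite ?tcons_lift ?tcons_ord0 //.
  exact: set_mem (valP x).
by move/eN: hx; rewrite comp_tcons tcons_tcat.
Qed.

Lemma elementary_submodel_ne (N : set D) : elementary_submodel S N -> N !=set0.
Proof. by move=> [[[x] _ _] _]; exists (val x); apply: set_mem (valP x). Qed.

Lemma tp_dfn (N : set D) m (b c : 'I_m -> D) :
  tp S b N `<=` tp S c N <-> forall X, dfn S N X -> X b -> X c.
Proof.
split=> [h X [psi o ->] hb|h psi [o hb]]; first by have [] := h psi (conj o hb).
by split=> //; apply: (h (dset S psi)) => //; apply: dfn_dset.
Qed.

Lemma tp_sub_sym (N : set D) m (b c : 'I_m -> D) :
  tp S b N `<=` tp S c N -> tp S c N `<=` tp S b N.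
Proof.
move=> /tp_dfn h; apply/tp_dfn => X dX Xc; apply: contrapT => nb.
exact: h (dfnC dX) nb Xc.
Qed.

Lemma automorphism_tp (N : set D) m (b : 'I_m -> D) sigma : automorphism S sigma ->
  {in N, sigma =1 id} -> tp S b N `<=` tp S (sigma \o b) N.
Proof.
move=> aut fixN psi [o h]; split=> //; rewrite /pf_sat.
have -> : pf_par psi = sigma \o pf_par psi.
  by apply/funext => i /=; rewrite fixN // inE.
by rewrite -comp_tcat automorphism_sat.
Qed.

(* [e] realizes a coheir of [tp(b/N)], and coheirs do not split over [N]. *)
Lemma coheir_realization (N P : set D) m (b : 'I_m -> D) :
  elementary_submodel S N -> is_small K P -> N `<=` P ->
  exists e : 'I_m -> D, tp S b N `<=` tp S e N /\
    forall k (b1 b2 : 'I_k -> D), (forall i, P (b1 i)) -> (forall i, P (b2 i)) ->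
      tp S b1 N `<=` tp S b2 N -> tp S (tcat b1 e) N `<=` tp S (tcat b2 e) N.
Proof.
move=> eN sP NP; pose NN : set ('I_m -> D) := [set v | forall i, N (v i)].
pose F : set (set ('I_m -> D)) := [set X | exists2 psi, tp S b N psi & dset S psi `&` NN `<=` X].
have [||U [uU FU]] := @filter_ultra _ F.
- split.
  + have [psi o E] := dfnT S N m; exists psi => //; split=> //.
    by have : dset S psi b by rewrite -E.
  + move=> X Y [psi [o h] sX] [chi [o' h'] sY]; exists (pf_and psi chi).
      split; first exact: pf_and_over.
      by have : dset S (pf_and psi chi) b by rewrite dset_and.
    by rewrite dset_and => v [[p1 p2] nv]; split; [apply: sX|apply: sY].
  + by move=> X Y XY [psi h sX]; exists psi => //; apply: subset_trans XY.
- move=> [[k phi c] [o h] sF].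
  have [|v Nv hv] := elementary_submodel_witness (phi := phi) eN o; first by exists b.
  exact: sF v (conj hv Nv).
have [e _ he] := monster_saturated hD (fun _ _ => I) sP (utype_complete S P uU).
have eU X : dfn S P X -> X e -> U X.
  move=> [psi o ->] Xe; apply: contrapT => /(ultraC uU) nU.
  by apply: (he (pf_neg psi) (conj o nU)).
have Ue X : dfn S P X -> U X -> X e.
  by move=> [psi o ->] UX; apply: he.
exists e; split.
  apply/tp_dfn => X dX Xb; apply: Ue; first exact: dfn_mono dX.
  by apply: FU; have [psi o E] := dX; rewrite E in Xb *; exists psi => // v [].
move=> k b1 b2 Pb1 Pb2 /tp_dfn h; apply/tp_dfn => X dX X1; apply: contrapT => nX2.
have sw (b' : 'I_k -> D) (Y : set ('I_(k + m) -> D)) : (forall i, P (b' i)) -> dfn S N Y -> dfn S P [set v | Y (tcat b' v)].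
  move=> Pb' dY; have d := dfn_ren (tcat (@rshift m k) (lshift k)) (dfn_mono NP dY).
  have := dfn_par Pb' d; congr dfn; apply/predeqP => v /=.
  by rewrite comp_tcat tcat_comp_l tcat_comp_r.
have UX := eU _ (dfnI (sw b1 X Pb1 dX) (sw b2 _ Pb2 (dfnC dX))) (conj X1 nX2).
have UN : U NN.
  apply: FU; have [psi o E] := dfnT S N m; exists psi; last by move=> v [].
  by split=> //; have : dset S psi b by rewrite -E.
have [v [[h1 h2] Nv]] := filter_ex (filterI UX UN).
by apply: h2; apply: (h [set w | X (tcat w v)]) h1; apply: dfn_par.
Qed.

(** The main case is an automorphism fixing a model [N]. A coheir realization [e] of the type of [b]
    over [N] is equivalent to some representative realizing that type, hence by non-splitting and
    invariance to [b] and [sigma \o b] as well. *)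
Lemma Ls_refines (C : set D) m (I : finType) (Eq : ('I_m -> D) -> ('I_m -> D) -> Prop)
  (r : I -> 'I_m -> D) :
  (forall b, Eq b b) -> (forall b c, Eq b c -> Eq c b) ->
  (forall b c d, Eq b c -> Eq c d -> Eq b d) ->
  (forall sigma b c, automorphism S sigma -> {in C, sigma =1 id} ->
    Eq b c -> Eq (sigma \o b) (sigma \o c)) ->
  (forall b, exists i, Eq b (r i)) ->
  forall b c, Ls_equiv S K C b c -> Eq b c.
Proof.
move=> Er Es Et Ei Eb b c [sigma aut E].
have {c E}-> : c = sigma \o b by apply/funext => i; rewrite -E.
elim: aut b => {sigma} [sigma N aut [eN sN] CN fixN||sigma tau _ IH _ IH'|sigma tau _ IH sK tK] b.
- have [x0 N0] := elementary_submodel_ne eN.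
  (* Every class that contains a realization of the type of [b] over [N] gets such a realization as
     its representative. *)
  have /choice [r' r'P] (i : I) : exists b', tp S b N `<=` tp S b' N /\
      forall e, tp S b N `<=` tp S e N -> Eq e (r i) -> Eq b' (r i).
    have [[e [h h']]|n] := EM (exists e, tp S b N `<=` tp S e N /\ Eq e (r i)).
      by exists e.
    by exists b; split=> // e h h'; case: n; exists e.
  pose c := sigma \o b.
  have bc : tp S b N `<=` tp S c N by apply: automorphism_tp.
  pose P := N `|` (range b `|` range c `|` range (fun p : I * 'I_m => r' p.1 p.2)).
  have sP : is_small K P.
    apply: (small_setU hD) => //; apply: (small_finite hD).
    by rewrite !finite_setU; split; [split|]; apply: finite_image; apply: finite_finset.
  have [|e [be he]] := @coheir_realization N P m b eN sP; first by move=> x; left.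
  have [i ei] := Eb e.
  have [br' hr'] := r'P i.
  have er' : Eq e (r' i) by apply: (Et _ _ _ ei); apply/Es/(hr' _ be ei).
  (* By non-splitting, [d] and [r' i] have the same type over [N] and [e]; an automorphism fixing
     [N] and [e] carries [r' i] to [d]. *)
  have key d : (forall i, P (d i)) -> tp S b N `<=` tp S d N -> Eq d e.
    move=> Pd bd; have [||tau [aut' fix' h]] := @monster_homog _ _ _ _ _ hD N _ (tcat (r' i) e) (tcat d e) sN.
    - by exists x0.
    - apply: he => // [j|]; first by right; right; exists (i, j).
      by apply: subset_trans (tp_sub_sym br') bd.
    have h1 : tau \o r' i = d.
      by rewrite -(tcat_comp_l (r' i) e) -(tcat_comp_l d e) -h compA.
    have h2 : tau \o e = e.
      by rewrite -{1}(tcat_comp_r (r' i) e) -{2}(tcat_comp_r d e) -h compA.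
    rewrite -h1 -h2; apply: Ei => //; last exact: Es.
    by move=> x; rewrite inE => /CN Nx; apply: fix'; rewrite inE.
  apply: (Et _ e); first by apply: key => // j; right; left; left; exists j.
  by apply: Es; apply: key => // j; right; left; right; exists j.
- exact: Er b.
- by apply: Et (IH' b) (IH _).
- have := IH (tau \o b); have -> : sigma \o (tau \o b) = b by apply/funext => i /=.
  exact: Es.
Qed.

End Lascar.

(** * From stability to independence along chains *)

Section Derive.
Variables (L : language) (D : Type) (S : structure L D).
Variables (n m : nat) (phi : formula L (n + m)).
Local Notation E := ('I_n -> D).
Local Notation inst := (inst S phi).
Local Notation rk := (rk S phi).

Inductive lconj : set (set E) :=
| lconjT : lconj setT
| lconjP X b : lconj X -> lconj (X `&` inst b)
| lconjN X b : lconj X -> lconj (X `&` ~` inst b).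

(* The ultrafilters above [derive N F] are those above [F] that avoid every
   conjunction of [phi]-literals on which some member of [F] has rank below [N]. *)
Definition bad N (F : set (set E)) (X : set E) : Prop :=
  lconj X /\ exists2 P, F P & ~ rk N (P `&` X).

Definition derive N (F : set (set E)) : set (set E) :=
  fgen (F `|` [set Y | exists2 X, bad N F X & Y = ~` X]).

Lemma bad_mono N F G X : F `<=` G -> bad N F X -> bad N G X.
Proof. by move=> FG [cX [P FP h]]; split=> //; exists P => //; apply: FG. Qed.

Lemma derive_mono N F G : F `<=` G -> derive N F `<=` derive N G.
Proof.
move=> FG; apply: fgen_mono => Y [/FG|[X bX ->]]; first by left.
by right; exists X => //; apply: bad_mono bX.
Qed.

Lemma sub_derive N F : F `<=` derive N F.
Proof. by move=> P FP; apply: fgen_in; left. Qed.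

Lemma derive_bad N F X : bad N F X -> derive N F (~` X).
Proof. by move=> bX; apply: fgen_in; right; exists X. Qed.

Lemma derive0 F : Filter F -> derive 0 F `<=` F.
Proof.
move=> fF; apply: fgen_min => // Y [//|[X [_ [P FP h]] ->]].
by apply: filterS FP => x Px Xx; apply: h; exists x.
Qed.

Lemma derive_improper N F P : F P -> ~ rk N P -> derive N F set0.
Proof.
move=> FP h; rewrite -setCT; apply: derive_bad; split; first exact: lconjT.
by exists P; rewrite ?setIT.
Qed.

(** A derivation uses finitely many bad sets; only the first [k] values of [X] count, the others are
    fillers. *)
Lemma derive_cover N F Q : Filter F -> derive N F Q ->
  exists P k (X : nat -> set E), [/\ F P, forall i, i < k -> bad N F (X i)
    & forall x, P x -> (forall i, i < k -> ~ X i x) -> Q x].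
Proof.
move=> fF; elim=> {Q} [|Q [FQ|[X bX ->]]|Q Q' _ [P [k [X [FP bX h]]]] _ [P' [k' [X' [FP' bX' h']]]]
  |Q Q' QQ' _ [P [k [X [FP bX h]]]]].
- by exists setT, 0, (fun=> setT); split=> //; apply: filterT.
- by exists Q, 0, (fun=> setT).
- by exists setT, 1, (fun=> X); split=> // [|x _ hx]; [apply: filterT|apply: (hx 0)].
- exists (P `&` P'), (k + k'), (fun i => if i < k then X i else X' (i - k)); split.
  + exact: filterI.
  + move=> i ik; case: ifP => [/bX //|]; rewrite ltnNge => /negbFE ki; apply: bX'.
    by rewrite ltn_subLR.
  + move=> x [Px Px'] hx; split.
      by apply: h => // i ik; have := hx i; rewrite ik; apply; apply: ltn_addr.
    apply: h' => // i ik; have := hx (k + i); rewrite ltn_add2l ik (ltnNge (k + i) k) leq_addr /= addKn.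
    exact.
- by exists P, k, X; split=> // x Px hx; apply/QQ'/h.
Qed.

Lemma lconj_automorphism sigma X : automorphism S sigma ->
  lconj X -> lconj [set x | X (sigma \o x)].
Proof.
move=> aut; have [[tau sK tK] _ _] := aut.
have ei b x : inst b (sigma \o x) <-> inst (tau \o b) x.
  have -> : b = sigma \o (tau \o b) by apply/funext => i /=.
  have -> : tau \o (sigma \o (tau \o b)) = tau \o b by apply/funext => i /=.
  exact: inst_automorphism.
elim=> {X} [|X b _ h|X b _ h]; first exact: lconjT.
  have := lconjP (tau \o b) h; congr lconj; apply/predeqP => x /=.
  by split=> -[? /ei].
have := lconjN (tau \o b) h; congr lconj; apply/predeqP => x /=.
by split=> -[? h']; split=> // /ei.
Qed.

Lemma derive_automorphism N F sigma : automorphism S sigma ->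
  (forall P, F P -> F [set x | P (sigma \o x)]) ->
  forall P, derive N F P -> derive N F [set x | P (sigma \o x)].
Proof.
move=> aut iF P; elim=> {P} [|P [FP|[X [cX [P' FP' h]] ->]]|P Q _ h _ h'|P Q PQ _ h].
- exact: fgenT.
- by apply: sub_derive; apply: iF.
- apply: (@derive_bad _ _ [set x | X (sigma \o x)]); split.
    exact: lconj_automorphism.
  exists [set x | P' (sigma \o x)]; first exact: iF.
  by move=> h'; apply: h; apply/(rk_automorphism phi N _ aut).
- exact: fgenI h h'.
- by apply: fgenS h => x; apply: PQ.
Qed.

(* If [derive N] adds nothing to [F] while [derive N.+1] makes it improper,
   then an ultrafilter above [F] contains one of finitely many [X i], and for
   each [b] at most one of [X i & inst b], [X i & ~ inst b] is not [N]-bad. *)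
Lemma finitely_many_phi_types N F : Filter F ->
  derive N.+1 F set0 -> derive N F `<=` F ->
  exists (I : finType) (cl : ('I_m -> D) -> I), forall b c, cl b = cl c ->
    F [set a | inst b a <-> inst c a].
Proof.
move=> fF /(derive_cover fF) [P [k [X [FP bX hX]]]] dF.
(* [cl b] records for which [i] the part of [X i] outside [inst b] is bad. *)
pose cl b := [set i : 'I_k | `[< bad N F (X i `&` ~` inst b) >]]%SET.
exists {set 'I_k}, cl => b c E; apply: contrapT => nF.
have [U [uU FU nU]] := filter_notin_ultra fF nF.
have nbad Y : bad N F Y -> ~ U Y.
  by move=> /derive_bad /dF /FU UY /ultra_notin.
(* [U] contains some [X i] and avoids bad sets; so if it contains [inst b'], the other half of [X i]
   is bad, and by equality of classes the same holds for [c']. *)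
have key b' c' : cl b' = cl c' -> U (inst b') -> U (inst c').
  move=> E' Ub; apply: contrapT => /(ultraC uU) Uc.
  have [i ik UX] : exists2 i, i < k & U (X i).
    apply: contrapT => n0; apply: (@filter_not_empty _ U).
    have h : U (\bigcap_(i in `I_k) ~` X i).
      apply: filter_finite_bigcap; first exact: finite_II.
      by move=> i ik; apply: ultraC => // UX; apply: n0; exists i.
    by apply: (@filterS _ U _ _ _ _ (filterI (FU _ FP) h)) => x [Px hx]; apply: hX Px hx.
  have [cX [P' FP' nr]] := bX i ik.
  have bN : bad N F (X i `&` ~` inst b').
    apply: contrapT => nb; apply: (nbad (X i `&` inst b')); last exact: filterI.
    split; first exact: lconjP.
    exists P' => // h; apply: nr; exists b'; rewrite -!setIA; split=> //.
    apply: contrapT => h'; apply: nb; split; first exact: lconjN.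
    by exists P'.
  have : Ordinal ik \in cl b' by rewrite inE; apply/asboolP.
  by rewrite E' inE => /asboolP /nbad; apply; apply: filterI.
apply: nU; have [Ub|nb] := EM (U (inst b)).
  have Uc := key _ _ E Ub.
  by apply: (@filterS _ U _ _ _ _ (filterI Ub Uc)) => x [].
have nc : ~ U (inst c) by move=> /(key _ _ (esym E)).
by apply: (@filterS _ U _ _ _ _ (filterI (ultraC uU nb) (ultraC uU nc))) => x [].
Qed.

End Derive.

(** * Maximal invariant systems of filters along a chain *)

Section Chain.
Variables (L : language) (D : Type) (S : structure L D).
Variables (T : set (sentence L)) (K : Type) (hD : monster_model S T K).
Variables (J : Type) (R : rel J) (hJ : order_type_succ_card (lang_card L) R).
Variables (n : nat) (a : 'I_n -> D) (B : J -> set D).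
Hypothesis B_mono : forall i j, R i j -> B i `<=` B j.
Local Notation E := ('I_n -> D).

Definition invariant_system (G : J -> set (set E)) : Prop :=
  [/\ forall j, Filter (G j) /\ ~ G j set0,
      forall i j, R i j -> G i `<=` G j,
      forall j psi, tp S a (B j) psi -> G j (dset S psi)
    & forall j sigma, automorphism S sigma -> {in B j, sigma =1 id} ->
      forall P, G j P -> G j [set x | P (sigma \o x)]].

Lemma tp_system : invariant_system
  (fun j => [set X | exists2 psi, tp S a (B j) psi & dset S psi `<=` X]).
Proof.
split=> [j|i j ij X [psi [o h] s]|j psi h|j sigma aut fixB X [psi [o h] s]].
- split; last by move=> [psi [o h] s]; apply: (s a).
  split.
  + have [psi o e] := dfnT S (B j) n; exists psi => //; split=> //.
    by have : dset S psi a by rewrite -e.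
  + move=> X Y [psi [o h] s] [chi [o' h'] s']; exists (pf_and psi chi).
      split; first exact: pf_and_over.
      by have : dset S (pf_and psi chi) a by rewrite dset_and.
    by rewrite dset_and => x [/s ? /s'].
  + by move=> X Y XY [psi h s]; exists psi => //; apply: subset_trans XY.
- by exists psi => //; split=> // k; apply: B_mono ij _ (o k).
- by exists psi.
- exists psi => // x hx; apply: s; rewrite /dset /pf_sat /=.
  have -> : pf_par psi = sigma \o pf_par psi.
    by apply/funext => i /=; rewrite fixB // inE.
  by rewrite -comp_tcat automorphism_sat.
Qed.

Lemma ex_maximal_system : exists2 G, invariant_system G &
  forall G', invariant_system G' -> (forall j, G j `<=` G' j) -> forall j, G' j `<=` G j.
Proof.
pose Sys := {G | invariant_system G}.
pose le (G G' : Sys) := `[< forall j, sval G j `<=` sval G' j >].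
have [|||[G sG] Gmax] := @ZL_preorder Sys (exist _ _ tp_system) le.
- by move=> G; apply/asboolP => j P.
- by move=> G1 G2 G3 /asboolP h /asboolP h'; apply/asboolP => j; apply: subset_trans (h j) (h' j).
- move=> C tot; have [[G0 C0]|n0] := EM (exists G, C G); last first.
    by exists (exist _ _ tp_system) => G CG; case: n0; exists G.
  pose U j : set (set E) := [set P | exists2 G, C G & sval G j P].
  have dir G G' : C G -> C G' -> exists2 H, C H &
      forall j, sval G j `<=` sval H j /\ sval G' j `<=` sval H j.
    move=> CG CG'; have [/asboolP h|/asboolP h] := tot _ _ CG CG'.
      by exists G' => // j; split=> //; apply: h.
    by exists G => // j; split=> //; apply: h.
  suff sU : invariant_system U.
    by exists (exist _ _ sU) => G CG; apply/asboolP => j P h; exists G.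
  split=> [j|i j ij P [G CG h]|j psi h|j sigma aut fixB P [G CG h]].
  + split; last by move=> [G _]; have [/(_ j) []] := svalP G.
    split.
    * by exists G0 => //; have [/(_ j) [f _] _ _ _] := svalP G0; apply: filterT.
    * move=> P Q [G CG h] [G' CG' h']; have [H CH GH] := dir _ _ CG CG'.
      exists H => //; have [/(_ j) [f _] _ _ _] := svalP H.
      by have [g g'] := GH j; apply: filterI; [apply: g|apply: g'].
    * move=> P Q PQ [G CG h]; exists G => //; have [/(_ j) [f _] _ _ _] := svalP G.
      exact: filterS h.
  + by exists G => //; have [_ m _ _] := svalP G; apply: m ij _ h.
  + by exists G0 => //; have [_ _ t _] := svalP G0; apply: t.
  + by exists G => //; have [_ _ _ inv] := svalP G; apply: inv.
exists G => // G' sG' GG' j.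
by have /asboolP := Gmax (exist _ _ sG') (asboolT GG'); apply.
Qed.

Lemma derive_system m (phi : formula L (n + m)) N G : invariant_system G ->
  (forall j, ~ derive S phi N (G j) set0) ->
  invariant_system (fun j => derive S phi N (G j)).
Proof.
move=> [fG mG tG iG] pr; split=> [j|i j ij|j psi h|j sigma aut fixB].
- by split; [apply: fgen_filter|apply: pr].
- exact: derive_mono (mG _ _ ij).
- by apply: sub_derive; apply: tG.
- by apply: derive_automorphism => //; apply: iG.
Qed.

(** Take the least [M] for which deriving at [M.+1] makes some [G j] improper; the rank bound on [P]
    shows that one exists. Deriving at [M] keeps every [G j] proper, so by maximality it adds
    nothing. *)
Lemma maximal_system_finite m (phi : formula L (n + m)) G j0 P N :
  invariant_system G ->
  (forall G', invariant_system G' -> (forall j, G j `<=` G' j) -> forall j, G' j `<=` G j) ->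
  G j0 P -> ~ rk S phi N P ->
  exists j1, forall j, R j1 j ->
    exists (I : finType) (cl : ('I_m -> D) -> I), forall b c, cl b = cl c ->
      G j [set x | inst S phi b x <-> inst S phi c x].
Proof.
move=> sG Gmax GP nr; have [fG mG _ _] := sG.
pose bd M := `[< exists j, derive S phi M.+1 (G j) set0 >].
have ex : exists M, bd M.
  exists N; apply/asboolP; exists j0; apply: (@derive_improper _ _ _ _ _ _ _ _ P) => //.
  by move=> /rkS.
have [M /asboolP [j1 h1] min] := ex_minnP ex.
have sM : invariant_system (fun j => derive S phi M (G j)).
  apply: derive_system => // j h.
  (* For [M = 0], deriving adds nothing to a filter, so it cannot make one improper. *)
  case: M h min {h1} => [|M] h min.
    have [f pr] := fG j; apply: pr; exact: derive0 h.
  by have := min M (asboolT (ex_intro _ j h)); rewrite ltnn.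
exists j1 => j j1j; have [f _] := fG j.
apply: (@finitely_many_phi_types _ _ _ _ _ phi M).
- by apply: derive_mono h1; apply: mG.
- by apply: (Gmax _ sM _ j) => i; apply: sub_derive.
Qed.

Lemma stable_chain (A : set D) (p : set (pformula L D n)) :
  is_small K A -> partial_type S A p -> stable S K A p -> realizes S a p ->
  (forall j, A `<=` B j) -> exists j k, is_succ R j k /\ i_indep S K a (B k) (B j).
Proof.
move=> sA [pA _] st ap AB; have [hR nJ segJ] := hJ.
have iN := emb_nat_lang_card L.
have [G sG Gmax] := ex_maximal_system.
have [fG mG tG iG] := sG.
have [j00 _] : exists j : J, True.
  apply: contrapT => n0; apply: nJ; apply/card_leE_rel; exists (fun _ _ => True).
    by move=> _ j; case: n0; exists j.
  by move=> j; case: n0; exists j.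
have fin (q : {m & formula L (n + m)}) : exists j1, forall j, R j1 j ->
    exists (I : finType) (cl : ('I_(projT1 q) -> D) -> I), forall b c, cl b = cl c ->
      G j [set x | inst S (projT2 q) b x <-> inst S (projT2 q) c x].
  case: q => m phi; have [N [P [gP nr]]] := stable_rk phi hD sA pA st.
  apply: (maximal_system_finite sG Gmax (j0 := j00) (P := P) (N := N)) => //.
  have [f _] := fG j00; apply: fgen_min gP => X [psi ppsi ->].
  apply: tG; split; last exact: ap.
  by move=> i; apply/AB/pA.
have /choice [f fP] := fin.
(* There are at most [|T|] formulas, so by regularity one index serves all of them. *)
have [j hj] : exists j, forall q, R (f q) j.
  apply: (succ_card_bounded hR iN nJ segJ).
  by apply: emb_sigma_le => // m; apply: emb_formula.
have [k jk] := succ_card_succ hR iN nJ segJ j.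
exists j, k; split=> //; have Rjk : R j k by have [[]] := jk.
(* [U] lies above [G k], which contains the type of [a] over [B k], while the finite equivalence
   relations come from [G j] and are invariant over [B j]. *)
have [fk pk] := fG k; have [U [uU GU]] := filter_ultra fk pk.
exists (utype S U setT); split; first exact: utype_complete.
  move=> psi [o h]; split=> //; apply/GU/tG; split=> // i.
  by case: (o i) => // Bj; apply: B_mono Rjk _ Bj.
move=> [m [phi [b [c [_ _ bc [_ Ub] [_ Uc]]]]]].
have [I [cl hcl]] := fP (existT _ m phi) j (hj _).
have : G j [set x | inst S phi b x <-> inst S phi c x].
  have [fj _] := fG j.
  pose Eq b c := G j [set x | inst S phi b x <-> inst S phi c x].
  (* One representative per value of [cl]; values that are not taken get [b]. *)
  have /choice [r rP] (i : I) : exists b' : 'I_m -> D, forall b'', cl b'' = i -> cl b' = i.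
    have [[b' e]|n0] := EM (exists b', cl b' = i); first by exists b'.
    by exists b => b'' e; case: n0; exists b''.
  apply: (Ls_refines hD (Eq := Eq) (r := r) _ _ _ _ _ bc) => [b'|b' c'|b' c' d'|sigma b' c' aut fixB|b'].
  - by apply: (@filterS _ (G j) _ setT) => //; apply: filterT.
  - by apply: filterS => x [].
  - move=> h h'; apply: (@filterS _ (G j) _ _ _ _ (filterI h h')) => x [/= [e1 e2] [e3 e4]].
    by split=> ?; [apply/e3/e1|apply/e2/e4].
  - have [[tau sK tK] _ _] := aut.
    have aut' : automorphism S tau.
      exact: automorphism_inv aut sK tK.
    have fixB' : {in B j, tau =1 id} by move=> x Bx; rewrite -{1}(fixB x Bx) sK.
    move=> /(iG j tau aut' fixB'); apply: filterS => x /=.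
    have e d : inst S phi d (tau \o x) <-> inst S phi (sigma \o d) x.
      rewrite -(inst_automorphism phi d _ aut).
      by have -> : sigma \o (tau \o x) = x by apply/funext => i /=.
    by rewrite !e.
  - by exists (cl b'); apply: hcl; rewrite (rP _ b').
move=> /(mG _ _ Rjk) /GU UE.
have [x [[[h _] ib] nc]] := filter_ex (filterI (filterI UE Ub) Uc).
exact/nc/h.
Qed.

End Chain.

(** * Compactness of independence *)

Section Independence.
Variables (L : language) (D : Type) (S : structure L D) (K : Type) (n : nat).
Variable a : 'I_n -> D.
Local Notation E := ('I_n -> D).

Definition tp_sets (B : set D) : set (set E) :=
  [set X | exists2 psi, tp S a B psi & X = dset S psi].

Definition Ls_sets (C : set D) : set (set E) :=
  [set X | exists m (phi : formula L (n + m)) b c,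
    Ls_equiv S K C b c /\ X = [set x | inst S phi b x -> inst S phi c x]].

(** Not splitting amounts to containing every implication from [phi(x, b)] to [phi(x, c)] with [b]
    and [c] Lascar equivalent, so independence becomes consistency of a partial type and acquires
    finite character. *)
Lemma i_indep_fgen (B C : set D) :
  i_indep S K a B C <-> ~ fgen (tp_sets (B `|` C) `|` Ls_sets C) set0.
Proof.
split=> [[q [cq aq nq]] g|/fgen_ultra [U [uU FU]]].
  have [F [fF Fq hF]] : exists F, [/\ finite_set F, F `<=` q &
      \bigcap_(psi in F) dset S psi `<=` set0].
    have ft psi : q psi -> exists F, [/\ finite_set F, F `<=` q &
        \bigcap_(psi in F) dset S psi `<=` dset S psi].
      move=> qpsi; exists [set psi]; split=> [|_ -> //|x]; first exact: finite_set1.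
      by apply.
    elim: g => {}[|X [[psi /aq qpsi ->]|[m [phi [b [c [bc ->]]]]]]|X Y _ [F [f1 f2 f3]] _ [F' [f1' f2' f3']]
      |X Y XY _ [F [f1 f2 f3]]].
    - by exists set0; split.
    - exact: ft.
    - have [qb|qb] := cq.2 (PFormula phi b) (fun _ => I); last first.
        have [F [f1 f2 f3]] := ft _ qb; exists F; split=> //.
        by move=> x /f3 /= nb /nb.
      have [qc|qc] := cq.2 (PFormula phi c) (fun _ => I).
        by have [F [f1 f2 f3]] := ft _ qc; exists F; split=> // x /f3 h _.
      by case: nq; exists m, phi, b, c.
    - exists (F `|` F'); split; first by rewrite finite_setU.
        by move=> psi [/f2|/f2'].
      by move=> x hx; split; [apply: f3|apply: f3'] => psi h; apply: hx; [left|right].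
    - by exists F; split=> //; apply: subset_trans XY.
  have [x hx] := cq.1.2 F fF Fq.
  exact: hF x hx.
exists (utype S U setT); split; first exact: utype_complete.
  by move=> psi h; split=> //; apply: FU; left; exists psi.
move=> [m [phi [b [c [_ _ bc [_ Ub] [_ Uc]]]]]].
have UE : U [set x | inst S phi b x -> inst S phi c x] by apply: FU; right; exists m, phi, b, c.
have [x [[h ib] nc]] := filter_ex (filterI (filterI UE Ub) Uc).
exact/nc/h.
Qed.

Lemma i_indep_sub (B B' C : set D) : B' `<=` B `|` C ->
  i_indep S K a B C -> i_indep S K a B' C.
Proof.
move=> BB' [q [cq aq nq]]; exists q; split=> // psi [o h]; apply: aq; split=> // i.
by case: (o i) => [/BB' //|]; right.
Qed.

(** A derivation of inconsistency mentions finitely many parameters from [B]. *)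
Lemma i_dep_finite (B C : set D) : ~ i_indep S K a B C ->
  exists F, [/\ finite_set F, F `<=` B & ~ i_indep S K a F C].
Proof.
rewrite i_indep_fgen => /contrapT g.
suff [F [fF FB gF]] : exists F, [/\ finite_set F, F `<=` B & fgen (tp_sets (F `|` C) `|` Ls_sets C) set0].
  by exists F; split=> // /i_indep_fgen.
have mono F F' : F `<=` F' -> fgen (tp_sets (F `|` C) `|` Ls_sets C) `<=` fgen (tp_sets (F' `|` C) `|` Ls_sets C).
  move=> FF'; apply: fgen_mono => X [[psi [o h] ->]|]; last by right.
  left; exists psi => //; split=> // i.
  by case: (o i) => [/FF'|]; [left|right].
elim: g => {}[|X [[psi [o h] ->]|hX]|X Y _ [F [f1 f2 f3]] _ [F' [f1' f2' f3']]|X Y XY _ [F [f1 f2 f3]]].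
- by exists set0; split=> //; apply: fgenT.
- exists (range (pf_par psi) `&` B); split=> [|x []//|].
    by apply: finite_setIl; apply: finite_image; apply: finite_finset.
  apply: fgen_in; left; exists psi => //; split=> // i.
  by case: (o i) => [Bi|]; [left; split=> //; exists i|right].
- by exists set0; split=> //; apply: fgen_in; right.
- exists (F `|` F'); split; first by rewrite finite_setU.
    by move=> x [/f2|/f2'].
  by apply: fgenI; [apply: mono f3|apply: mono f3'] => x; [left|right].
- by exists F; split=> //; apply: fgenS f3.
Qed.

Variables (J : Type) (R : rel J) (hJ : order_type_succ_card (lang_card L) R).

(** If no [C] works, each small candidate [C] has a finite witness [F C] of dependence. Collecting
    at every stage the earlier sets and their witnesses keeps the size at most [|T|], as proper
    initial segments of [J] have that size, and makes each successor step dependent. *)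
Lemma chain_base (A B : set D) : is_small K B -> A `<=` B ->
  (forall Bs : J -> set D,
     (forall j, is_small K (Bs j)) -> (forall j, A `<=` Bs j) ->
     (forall i j, R i j -> Bs i `<=` Bs j) ->
     exists j k, is_succ R j k /\ i_indep S K a (Bs k) (Bs j)) ->
  exists C : set D, [/\ C `<=` B, C #<= [set: lang_card L] & i_indep S K a B (A `|` C)].
Proof.
move=> sB AB chain; apply: contrapT => nC; have [hR nJ segJ] := hJ.
have iN := emb_nat_lang_card L.
have /choice [F FP] (C : set D) : exists F, C `<=` B -> C #<= [set: lang_card L] ->
    [/\ finite_set F, F `<=` B & ~ i_indep S K a F (A `|` C)].
  have [[CB cC]|n0] := EM (C `<=` B /\ C #<= [set: lang_card L]); last first.
    by exists set0 => CB cC; case: n0.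
  have [|F hF] := @i_dep_finite B (A `|` C); last by exists F.
  by move=> h; apply: nC; exists C.
pose step j (rec : forall i, slt R i j -> set D) : set D :=
  [set x | exists i (h : slt R i j), (rec i h `|` F (rec i h)) x].
pose C := Fix (slt_wf hR) (fun=> set D) step.
have CE j : C j = [set x | exists2 i, slt R i j & (C i `|` F (C i)) x].
  rewrite /C Fix_eq => [|x f g fg].
    by apply/predeqP => x; split=> [[i [h hx]]|[i h hx]]; [exists i|exists i, h].
  by congr step; apply/functional_extensionality_dep => y; apply/funext => h; rewrite fg.
have CP j : C j `<=` B /\ C j #<= [set: lang_card L].
  elim/(well_founded_ind (slt_wf hR)): j => j IH; rewrite CE; split.
    move=> x [i /IH [CB cC]] [/CB //|]; have [_ h _] := FP _ CB cC; exact: h.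
  pose I := [set i | R i j /\ i <> j]%classic.
  have iI : emb I (lang_card L) by exact/card_le_emb/segJ.
  apply: card_le_trans (card_le_bigcup (F := fun i : I => C (val i) `|` F (C (val i))) iN iI _).
    apply: subset_card_le => x [i ij hx].
    by exists (SigSub (mem_set (ij : I i))).
  move=> i; have [CB cC] := IH (val i) (set_mem (valP i)).
  apply: card_leU => //; apply: card_le_finite_set => //.
  by have [] := FP _ CB cC.
have CF i j : slt R i j -> C i `|` F (C i) `<=` C j by move=> ij x hx; rewrite CE; exists i.
have [|||j [k [jk ind]]] := chain (fun j => A `|` C j).
- move=> j; apply: small_sub sB => x [/AB//|].
  by have [h _] := CP j; apply: h.
- by move=> j x; left.
- move=> i j ij x [|Cx]; first by left.
  have [<-|ne] := EM (i = j); first by right.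
  by right; apply: (CF i j) => //; left.
have [CB cC] := CP j; have [_ _] := FP _ CB cC; apply.
apply: i_indep_sub ind => x Fx; left; right.
by apply: (CF j k jk.1); right.
Qed.

End Independence.

(** * Saturated hulls *)

(** Formal names for the elements of a saturated hull: a leaf names a given element, a node names a
    coordinate of a chosen realization of a type over the elements named by its children. *)
Inductive wtree (Y I mu : Type) : Type :=
| WLeaf of Y
| WNode of I & (mu -> wtree Y I mu).

(* A tree is determined by the labels found along finite paths; [None] marks
   the paths that leave the tree. *)
Fixpoint wtree_labels Y I mu (t : wtree Y I mu) (s : seq mu) : option (Y + I) :=
  match t with
  | WLeaf y => if s is [::] then Some (inl y) else None
  | WNode i f => if s is x :: s' then wtree_labels (f x) s' else Some (inr i)
  end.

Lemma wtree_labels_inj Y I mu : injective (@wtree_labels Y I mu).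
Proof.
elim=> [y|i f IH] [y'|i' f'] /funeqP E; have := E [::] => //= -[->] //.
by congr WNode; apply/funext => x; apply: IH; apply/funext => s; apply: (E (x :: s)).
Qed.

Lemma emb_wtree X Y I mu : emb nat X -> emb Y X -> emb I X -> emb (seq mu -> X) X ->
  emb (wtree Y I mu) X.
Proof.
move=> iX hY hI hX; apply: emb_trans hX.
have h : emb (wtree Y I mu) (seq mu -> option (Y + I)).
  by exists (@wtree_labels Y I mu); apply: wtree_labels_inj.
apply: emb_trans h (emb_fun _ _).
apply: (@emb_trans _ (unit + (Y + I))).
  exists (fun o => if o is Some z then inr z else inl tt).
  by move=> [z|] [z'|] // [->].
apply: emb_sum_le => //; last exact: emb_sum_le.
by apply: emb_trans iX; exists (fun=> 0) => -[] [].
Qed.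

Section Hull.
Variables (L : language) (D : Type) (S : structure L D).
Variables (T : set (sentence L)) (K : Type) (hD : monster_model S T K).

(** Tarski-Vaught test: the type of a witness over the finitely many parameters is realized inside
    [N]. Closure under functions is the case of the formula [x = f(w)]. *)
Lemma saturated_elementary (N : set D) (small : set D -> Prop) :
  N !=set0 -> (forall B, finite_set B -> small B) -> saturated S small N ->
  elementary_submodel S N.
Proof.
move=> [x0 N0] sfin sat_N.
have wit k (phi : formula L k.+1) (v : 'I_k -> D) : (forall i, N (v i)) ->
    (exists x, sat S phi (tcons x v)) -> exists2 x, N x & sat S phi (tcons x v).
  move=> Nv [x hx].
  have [||a Na ha] := sat_N (range v) _ _ _ _ (complete_tp S (fun _ : 'I_1 => x) (range v)).
  - by move=> _ [i _ <-].
  - by apply: sfin; apply: finite_image; apply: finite_finset.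
  exists (a ord0) => //; rewrite -tcat1.
  apply: (ha (PFormula (n := 1) (phi : formula L (1 + k)) v)); split; first by move=> i; exists i.
  by rewrite /pf_sat /= tcat1.
have Nf f (w : 'I_(far f) -> N) : N (ifun S (fun i => val (w i))).
  have Nw i : N (val (w i)) by apply: set_mem; apply: valP.
  have [|x Nx] := wit _ (FEq (TVar L ord0) (TApp (fun i => TVar L (lift ord0 i)))) _ Nw.
    by exists (ifun S (fun i => val (w i))); rewrite /= tcons_ord0; congr ifun;
      apply/funext => i; rewrite tcons_lift.
  rewrite /= tcons_ord0 => E; move: Nx; rewrite E; congr (N (ifun S _)).
  by apply/funext => i; rewrite tcons_lift.
pose SN : structure L N := Structure (inhabits (SigSub (mem_set N0)))
  (fun f w => SigSub (mem_set (Nf f w))) (fun r w => irel S (fun i => val (w i))).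
exists SN.
have ev k (t : term L k) (v : 'I_k -> N) : val (teval SN v t) = teval S (val \o v) t.
  by elim: t => //= f ts IH; congr ifun; apply/funext => i.
move=> k phi; elim: phi => {k} [k t u|k r ts|k psi IH|k psi IH chi IH'|k psi IH] v /=.
- by rewrite -!ev; split=> [->//|/val_inj].
- suff -> : (fun i => teval S (val \o v) (ts i)) = (fun i => val (teval SN v (ts i))) by [].
  by apply/funext => i; rewrite ev.
- by rewrite IH.
- by rewrite IH IH'.
- split=> [[x]|].
    by rewrite IH comp_tcons; exists (val x).
  move=> /wit [|x Nx hx]; first by move=> i; apply: set_mem; apply: valP.
  by exists (SigSub (mem_set Nx)); rewrite IH comp_tcons.
Qed.

Variables (mu X : Type).
Hypothesis Lmu : emb (lang_card L) mu.
Hypothesis mu_small : card_lt [set: mu] [set: K].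
Hypothesis muX : emb (set mu) X.
Hypothesis seqX : emb (seq mu -> X) X.

Let imu : emb nat mu.
Proof. exact: emb_trans (emb_nat_lang_card L) Lmu. Qed.

Let iX : emb nat X.
Proof. exact: emb_trans (emb_set_infinite imu) muX. Qed.

(* An [L]-formula in [k] variables whose parameters are replaced by names in [Z]. *)
Definition formula_index (Z : Type) k := {j & (formula L (k + j) * ('I_j -> Z))%type}.

Lemma emb_formula_index (Z Z' : Type) k : emb (lang_card L) Z' -> emb Z Z' ->
  emb (formula_index Z k) Z'.
Proof.
move=> h h'; have iZ := emb_trans (emb_nat_lang_card L) h.
apply: emb_sigma_le => // j; apply: emb_prod_le => //; last exact: emb_tuple.
exact: emb_trans (@emb_formula L _) h.
Qed.

(** A label is a coordinate together with a type in [k] variables whose parameters are the children,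
    indexed by [mu]. *)
Let label := {k & ('I_k * set (formula_index mu k))%type}.

Let emb_label : emb label X.
Proof.
apply: emb_sigma_le => // k; apply: emb_prod_le => //; first exact: emb_ord.
by apply: emb_trans muX; apply/emb_set/emb_formula_index => //; apply: emb_refl.
Qed.

(** The hull consists of the values of all well-founded names. It is saturated at one stroke: a type
    over at most [mu] named elements is itself the label of a node. *)
Lemma ex_saturated_hull (Y : Type) (g : Y -> D) : emb Y X -> inhabited Y ->
  exists h : X -> D, range g `<=` range h /\
    saturated S (fun B => B #<= [set: mu]) (range h).
Proof.
move=> hY [y0].
have [d] := dom_inh S.
have pickP k : exists pick : set (pformula L D k) -> 'I_k -> D,
    forall q, (exists a, realizes S a q) -> realizes S (pick q) q.
  suff /choice [f fP] (q : set (pformula L D k)) : exists a, (exists a', realizes S a' q) -> realizes S a q.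
    by exists f.
  by have [[a h]|n0] := EM (exists a, realizes S a q); [exists a|exists (fun=> d)].
pose pick k := sval (cid (pickP k)).
have pickE k (q : set (pformula L D k)) : (exists a, realizes S a q) -> realizes S (pick k q) q.
  exact: (svalP (cid (pickP k)) q).
pose decode (v : mu -> D) k (c : set (formula_index mu k)) : set (pformula L D k) :=
  [set psi | exists2 t, c t & psi = PFormula (projT2 t).1 (v \o (projT2 t).2)].
pose ev := fix ev (t : wtree Y label mu) : D :=
  match t with
  | WLeaf y => g y
  | WNode l f => pick _ (decode (fun x => ev (f x)) _ (projT2 l).2) (projT2 l).1
  end.
have [e ei] := emb_wtree iX hY emb_label seqX.
have /choice [h hP] (x : X) : exists y, (exists t, ev t = y) /\ forall t, e t = x -> ev t = y.
  have [[t E]|n0] := EM (exists t, e t = x).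
    by exists (ev t); split=> [|t']; [exists t|rewrite -E => /ei ->].
  exists (g y0); split=> [|t E]; first by exists (WLeaf _ _ y0).
  by case: n0; exists t.
have rh : range h = range ev.
  apply/predeqP => z; split=> [[x _ <-]|[t _ <-]].
    by have [[t <-] _] := hP x; exists t.
  by exists (e t) => //; rewrite ((hP (e t)).2 t).
exists h; rewrite rh; split=> [_ [y _ <-]|B k q BN cB cq]; first by exists (WLeaf _ _ y).
have /card_leE_rel [Q Q1 Q2] := cB.
(* [f] lists names for all elements of [B]; idle indices get a leaf. *)
have /choice [f fP] (z : mu) : exists t, forall x, B x -> Q z x -> ev t = x.
  have [[x Bx Qx]|n0] := EM (exists2 x, B x & Q z x).
    have [t _ E] := BN x Bx; exists t => x' Bx' Qx'.
    by rewrite E; apply: Q1 Qx Qx'.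
  by exists (WLeaf _ _ y0) => x Bx Qx; case: n0; exists x.
pose v x := ev (f x).
have Bv x : B x -> exists z, v z = x.
  by move=> Bx; have [z Qz] := Q2 x Bx; exists z; apply: fP.
pose c : set (formula_index mu k) := [set t | q (PFormula (projT2 t).1 (v \o (projT2 t).2))].
have dq : decode v k c = q.
  apply/predeqP => psi; split=> [[t ct ->] //|qpsi].
  have /choice [w wP] (i : 'I_(pf_len psi)) : exists z, v z = pf_par psi i.
    by apply: Bv; have [[qo _] _] := cq; apply: qo.
  have E : psi = PFormula (pf_fml psi) (v \o w).
    by case: psi {qpsi} w wP => j phi par w wP; congr PFormula; apply/funext => i /=.
  by exists (existT _ (pf_len psi) (pf_fml psi, w)); rewrite /c /= -E.
have sB : is_small K B := small_leT cB mu_small.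
have [a _ ha] := monster_saturated hD (fun _ _ => I) sB cq.
exists (pick k q) => [i|]; last by apply: pickE; exists a.
exists (WNode (existT _ k (i, c)) f) => //=.
by rewrite -/v dq.
Qed.

End Hull.

(** * Counting types *)

Section Counting.
Variables (L : language) (D : Type) (S : structure L D).
Variables (T : set (sentence L)) (K : Type) (hD : monster_model S T K).

Lemma card_lt_set X : card_lt [set: X] [set: K] -> card_lt [set: set X] [set: K].
Proof. exact: monster_limit hD X. Qed.

Section Codes.
Variables (Z : Type) (h : Z -> D).

Definition tp_code m (b : 'I_m -> D) : set (formula_index L Z m) :=
  [set t | sat S (projT2 t).1 (tcat b (h \o (projT2 t).2))].

Lemma tp_code_tp m (b c : 'I_m -> D) :
  tp_code b = tp_code c -> tp S b (range h) `<=` tp S c (range h).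
Proof.
move=> /predeqP E psi [o hb]; split=> //.
have /choice [w wP] (i : 'I_(pf_len psi)) : exists z, h z = pf_par psi i.
  by have [z _ <-] := o i; exists z.
have e : pf_par psi = h \o w by apply/funext => i /=.
move: hb; rewrite /pf_sat e => hb.
by have /E : tp_code b (existT _ (pf_len psi) (pf_fml psi, w)) by [].
Qed.

Variables (n : nat) (M : set D).

(** Parameter tuples are remembered only through their types over [range h], so the number of
    possible codes does not depend on [M]. *)
Definition global_type_code (q : set (pformula L D n)) :
    set {m & (formula L (n + m) * set (formula_index L Z m))%type} :=
  [set t | exists b, [/\ forall i, M (b i), tp_code b = (projT2 t).2
                       & q (PFormula (projT2 t).1 b)]].

(* Tuples of [M] with the same code are conjugate over the model [range h],
   hence Lascar equivalent over [C2]. *)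
Lemma global_type_code_tp (C2 B : set D) (a1 a2 : 'I_n -> D) (q1 q2 : set (pformula L D n)) :
  model S K (range h) -> C2 `<=` range h -> B `<=` M ->
  tp S a1 M `<=` q1 -> tp S a2 M `<=` q2 ->
  complete_type S setT q2 -> ~ Lascar_splits S K setT C2 q2 ->
  global_type_code q1 = global_type_code q2 -> tp S a1 B `<=` tp S a2 B.
Proof.
move=> mh C2h BM t1 t2 cq2 nL /predeqP E [m phi b] [/= o hb]; split=> //.
have Mb i : M (b i) by apply/BM/o.
have /E [b' [Mb' eb' qb']] : global_type_code q1 (existT _ m (phi, tp_code b)).
  by exists b; split=> //; apply: t1.
have [eh sh] := mh.
have [sigma [aut fixh sb]] :=
  monster_homog hD sh (elementary_submodel_ne eh) (tp_code_tp eb').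
have bb : Ls_equiv S K C2 b' b.
  exists sigma; last by move=> i; rewrite -sb.
  exact: Autf_gen aut mh C2h fixh.
apply: contrapT => nb.
have qn : q2 (pf_neg (PFormula phi b)) by apply: t2.
by apply: nL; exists m, phi, b', b.
Qed.

End Codes.

Lemma base_stable n (A : set D) (p : set (pformula L D n)) : is_small K A ->
  (forall a : 'I_n -> D, realizes S a p ->
   forall M : set D, model S K M -> A `<=` M ->
     saturated S (fun X => X #<= [set: (A + lang_card L)%type]) M ->
     exists C : set D, [/\ C `<=` M, C #<= [set: lang_card L]
                         & i_indep S K a M (A `|` C)]) ->
  stable S K A p.
Proof.
move=> sA base; pose mu := (A + lang_card L)%type.
have iN := emb_nat_lang_card L.
have Lmu : emb (lang_card L) mu by exists inr => x y [].
have Amu : emb A mu by exists inl => x y [].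
have imu : emb nat mu := emb_trans iN Lmu.
have kmu : card_lt [set: mu] [set: K].
  exact: card_lt_sum (small_type sA) (monster_large hD) iN.
(* Sizes for the small models, for the types over them, and for sets of such types. *)
pose X := set mu; pose chi := set X; pose Lam := set chi.
have kX : card_lt [set: X] [set: K] by apply: card_lt_set.
have kLam : card_lt [set: Lam] [set: K] by do 2 apply: card_lt_set.
have iX : emb nat X by apply: emb_set_infinite.
have ichi : emb nat chi by apply: emb_set_infinite.
have iLam : emb nat Lam by apply: emb_set_infinite.
have muX : emb mu X by apply: emb_set1.
have Xchi : emb X chi by apply: emb_set1.
have chiLam : emb chi Lam by apply: emb_set1.
have muchi := emb_trans muX Xchi.
have muLam := emb_trans muchi chiLam.
have seqmu : emb (seq mu) mu by apply: emb_seq => //; apply: emb_refl.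
exists Lam; split=> //; first exact/card_le_embE.
move=> B AB cB; have sB : is_small K B := small_leT cB kLam.
have [d] := dom_inh S.
have [g gB] : exists g : Lam -> D, B `<=` range g.
  have [||g gB gs] := @card_le_rangeP D Lam (B `|` [set d]) d; first by right.
    by apply: card_leU => //; apply: card_le_finite_set => //; apply: finite_set1.
  by exists g => x Bx; have [|y <-] := gs x; [left|exists y].
have [||||h [gh sat_h]] := @ex_saturated_hull L D S T K hD mu Lam Lmu kmu _ _ Lam g.
- exact: emb_trans Xchi chiLam.
- by apply: emb_fun_set => //; apply: emb_trans seqmu muchi.
- exact: emb_refl.
- exact: (inhabits set0).
pose M := range h.
have BM : B `<=` M by apply: subset_trans gB gh.
have AM : A `<=` M by apply: subset_trans AB BM.
have fmu (C : set D) : finite_set C -> C #<= [set: mu] by apply: card_le_finite_set.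
have mM : model S K M.
  split; last by apply: small_leT kLam; apply: card_le_range => x [y _ <-]; exists y.
  apply: saturated_elementary sat_h => //.
  by exists (h set0); exists set0.
(* For each [mu]-sequence in [M] one saturated model of size at most [X] containing it is fixed;
   there are at most [Lam] such sequences. *)
have /choice [H HP] (u : mu -> Lam) : exists H : X -> D, range (h \o u) `<=` range H /\
    saturated S (fun B => B #<= [set: mu]) (range H).
  apply: (@ex_saturated_hull L D S T K hD mu X Lmu kmu) => //.
  - exact: emb_refl.
  - by apply: emb_fun_set.
  - by have [e _] := imu; exact: (inhabits (e 0)).
have mH u : model S K (range (H u)).
  split; last by apply: small_leT kX; apply: card_le_range => x [y _ <-]; exists y.
  apply: saturated_elementary (HP u).2 => //.
  by exists (H u set0); exists set0.
pose code := set {m & (formula L (n + m) * set (formula_index L X m))%type}.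
have icode : emb code Lam.
  apply: emb_set; apply: emb_sigma_le => //.
  move=> m; apply: emb_prod_le => //.
    exact: emb_trans (emb_trans (@emb_formula L _) Lmu) muchi.
  apply/emb_set/emb_formula_index; first exact: emb_trans Lmu muX.
  exact: emb_refl.
have iU : emb (mu -> Lam) Lam by apply: emb_fun_set.
apply: card_le_trans_emb (emb_prod_le iLam iU icode).
apply/card_leE_rel.
(* A type is coded by a sequence [u] whose model contains a base [C], and by the code over that
   model of a global type not splitting over [C]. *)
exists (fun uc q => exists a q' C, [/\ complete_type S B q, realizes S a q,
  tp S a M `<=` q', complete_type S setT q' &
  [/\ ~ Lascar_splits S K setT C q', C `<=` range (H uc.1) & uc.2 = global_type_code (H uc.1) M q']]).
  move=> [u c] q1 q2 [a1 [q1' [C1 [cq1 r1 t1 cq1' [n1 C1u /= e1]]]]].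
  move=> [a2 [q2' [C2 [cq2 r2 t2 cq2' [n2 C2u /= e2]]]]].
  rewrite (complete_type_eq cq1 r1) (complete_type_eq cq2 r2); apply/seteqP.
  rewrite e1 in e2.
  split; first exact: (global_type_code_tp (mH u) C2u BM t1 t2 cq2' n2 e2).
  exact: (global_type_code_tp (mH u) C1u BM t2 t1 cq1' n1 (esym e2)).
move=> q [cq pq].
have [a _ aq] := monster_saturated hD (fun _ _ => I) sB cq.
have [C [CM cC [q' [cq' tq' nq']]]] := base a (fun psi h => aq psi (pq psi h)) M mM AM sat_h.
have cAC : (A `|` C) #<= [set: mu].
  apply: card_leU => //; first exact/card_le_emb.
  exact: card_le_trans_emb cC Lmu.
have [u uP] : exists u : mu -> Lam, A `|` C `<=` range (h \o u).
  have /card_leE_rel [Q Q1 Q2] := cAC.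
  have /choice [u uP] (z : mu) : exists y, forall x, (A `|` C) x -> Q z x -> h y = x.
    have [[x ACx Qx]|n0] := EM (exists2 x, (A `|` C) x & Q z x).
      have [y _ E] : M x by case: ACx => [/AM|/CM].
      by exists y => x' ACx' Qx'; rewrite E; apply: Q1 Qx Qx'.
    by exists set0 => x ACx Qx; case: n0; exists x.
  by exists u => x ACx; have [z Qz] := Q2 x ACx; exists z => //=; apply: uP.
exists (u, global_type_code (H u) M q'), a, q', (A `|` C); split=> //.
  by move=> psi [o ha]; apply: tq'; split=> // i; left.
by split=> //; apply: subset_trans uP (HP u).1.
Qed.

End Counting.

Theorem proposition3p2 (L : language) (T : set (sentence L))
  (K : Type) (D : Type) (S : structure L D)
  (hT : complete_theory T) (hD : monster_model S T K)
  (* (J, R) is the ordinal |T|^+ *)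
  (J : Type) (R : rel J) (hJ : order_type_succ_card (lang_card L) R)
  (A : set D) (hA : is_small K A)
  (n : nat) (p : set (pformula L D n)) (hp : partial_type S A p) :
  [<-> stable S K A p;

       forall a : 'I_n -> D, realizes S a p ->
       forall B : J -> set D,
         (forall j, is_small K (B j)) -> (forall j, A `<=` B j) ->
         (forall i j, R i j -> B i `<=` B j) ->
         exists j k, is_succ R j k /\ i_indep S K a (B k) (B j);

       forall a : 'I_n -> D, realizes S a p ->
       forall M : set D, model S K M -> A `<=` M ->
         saturated S (fun X => X #<= [set: (A + lang_card L)%type]) M ->
         exists C : set D, [/\ C `<=` M, C #<= [set: lang_card L]
                             & i_indep S K a M (A `|` C)];

       forall a : 'I_n -> D, realizes S a p ->
       forall B : set D, is_small K B -> A `<=` B ->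
         exists C : set D, [/\ C `<=` B, C #<= [set: lang_card L]
                             & i_indep S K a B (A `|` C)]].
Proof.
have chains_all : (forall a : 'I_n -> D, realizes S a p ->
    forall B : J -> set D,
      (forall j, is_small K (B j)) -> (forall j, A `<=` B j) ->
      (forall i j, R i j -> B i `<=` B j) ->
      exists j k, is_succ R j k /\ i_indep S K a (B k) (B j)) ->
  forall a : 'I_n -> D, realizes S a p ->
    forall B : set D, is_small K B -> A `<=` B ->
      exists C : set D, [/\ C `<=` B, C #<= [set: lang_card L] & i_indep S K a B (A `|` C)].
  by move=> chains a ap B sB AB; apply: (chain_base hJ sB AB); apply: chains.
have models_stable := base_stable hD (p := p) hA.
(* The cycle runs through the items in the listed order, so (2) implies (3) goes through (4), and
   (3) implies (4) is composed of (3) to (1), (1) to (2) and (2) to (4). *)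
rewrite /all_iff /=; split=> [st a ap B _ AB B_mono|].
  exact: (stable_chain hD hJ B_mono hA hp st ap AB).
split=> [/chains_all all a ap M [_ sM] AM _|]; first exact: all.
split=> [/models_stable st|all]; last first.
  by apply: models_stable => a ap M [_ sM] AM _; apply: all.
apply: chains_all => a ap B _ AB B_mono.
exact: (stable_chain hD hJ B_mono hA hp st ap AB).
Qed.
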